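(* Let $f\in\mathcal{A}$, let $$\mathcal{G}(z):=1-\frac{zf'(z)}{f(z)}+\frac{zf''(z)}{f'(z)},\qquad z\in\mathbb{D},$$ and let $\beta>0$. Suppose that $f$ satisfies $$\left(1+\beta\,\mathcal{G}(z)\right)\frac{zf'(z)}{f(z)}\prec\varphi_L(z):=\sqrt{1+z}.$$ Then $f\in\mathcal{S}^*_{Ne}$ for $\beta\geq\beta_L$, where $\beta_L$ is the unique root in $(0,\infty)$ of the equation (in the unknown $\beta$) $$\frac{3}{\Gamma(-\frac12)}\sum_{j=0}^\infty\frac{\Gamma(-\frac12+j)}{j!\,(1+j\beta)}-1=0.$$
   Context: $\mathbb{D}=\{z\in\mathbb{C}:|z|<1\}$, $\mathcal{H}$ is the set of all analytic functions on $\mathbb{D}$, and $\mathcal{A}$ is the set of $f\in\mathcal{H}$ with $f(0)=0$ and $f'(0)=1$. For $f,g\in\mathcal{H}$, $f\prec g$ ($f$ is subordinate to $g$) means that there is $w\in\mathcal{H}$ with $w(0)=0$ and $|w(z)|<1$ for $z\in\mathbb{D}$ such that $f(z)=g(w(z))$ on $\mathbb{D}$; in particular, writing a subordination presupposes that both sides are analytic in $\mathbb{D}$ (the removable singularity of $zf'(z)/f(z)$ at $0$ being filled with value $1$). The branch of the square root is chosen so that $\varphi_L(0)=1$. With $\varphi_{Ne}(z):=1+z-z^3/3$, $\mathcal{S}^*_{Ne}:=\{f\in\mathcal{A}:zf'(z)/f(z)\prec\varphi_{Ne}(z)\}$. $\Gamma$ is the Gamma function (so $\Gamma(-\frac12+j)/\Gamma(-\frac12)$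 is the Pochhammer symbol $(-\frac12)_j$). *)

(* Defs.v *)
From Stdlib Require Import Reals Lra Factorial.
From Coquelicot Require Import Coquelicot.

(* Conventions: [C_derive f z] is the complex derivative at every point where
   [f] is complex differentiable, and [Cinv] is total with [/ 0 = 0]. *)

Local Open Scope C_scope.

Definition in_disk (z : C) : Prop := (Cmod z < 1)%R.

(* Values of f outside the disk are irrelevant: r may be taken small enough
   for the ball to stay inside. *)
Definition analytic_on_disk (f : C -> C) : Prop :=
  forall z0 : C, in_disk z0 ->
  exists (a : nat -> C) (r : R), (0 < r)%R /\
    forall z : C, (Cmod (z - z0) < r)%R ->
      @is_pseries C_AbsRing C_NormedModule a (z - z0) (f z).

Definition classA (f : C -> C) : Prop :=
  analytic_on_disk f /\ f 0 = 0 /\ C_derive f 0 = 1.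

Definition subordinate (f g : C -> C) : Prop :=
  analytic_on_disk f /\ analytic_on_disk g /\
  exists w : C -> C,
    analytic_on_disk w /\ w 0 = 0 /\
    (forall z : C, in_disk z -> (Cmod (w z) < 1)%R) /\
    (forall z : C, in_disk z -> f z = g (w z)).

(* z f'(z) / f(z), with its removable singularity at 0 filled.  If f in
   [classA] had a zero z0 <> 0 in the disk, this function would have a pole
   there, hence would not be [analytic_on_disk]. *)
Definition star_quotient (f : C -> C) (z : C) : C :=
  if Ceq_dec z 0 then 1 else z * C_derive f z / f z.

(* No nonvanishing hypothesis on f or f' is needed: at a zero of f' (or at a
   zero of f other than 0) the product (1 + beta calG f z) * star_quotient f z
   evaluates to 0, a value that [phi_L] does not take in the disk, so being
   subordinate to [phi_L] already forces calG f to be well defined. *)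
Definition calG (f : C -> C) (z : C) : C :=
  1 - star_quotient f z + z * C_derive (C_derive f) z / C_derive f z.

(* Principal square root, analytic off the half-line (-oo, 0]. *)
Definition Csqrt (c : C) : C :=
  (sqrt ((Cmod c + Re c) / 2),
   (if Rlt_dec (Im c) 0 then -1 else 1) * sqrt ((Cmod c - Re c) / 2))%R.

Definition phi_L (z : C) : C := Csqrt (1 + z).

Lemma Csqrt_sqr (c : C) : Csqrt c * Csqrt c = c.
Proof.
assert (Hre : (Rabs (Re c) <= Cmod c)%R) by apply re_le_Cmod.
assert (Hm := Cmod2_alt c). destruct c as [a b]; simpl in Hre, Hm.
unfold Csqrt; simpl. set (m := Cmod (a, b)) in *.
assert (Hp : (0 <= (m + a) / 2)%R) by (unfold Rabs in Hre; destruct (Rcase_abs a); lra).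
assert (Hn : (0 <= (m - a) / 2)%R) by (unfold Rabs in Hre; destruct (Rcase_abs a); lra).
assert (Hprod : (sqrt ((m + a) / 2) * sqrt ((m - a) / 2) = Rabs b / 2)%R).
{ rewrite <- sqrt_mult by assumption.
  replace ((m + a) / 2 * ((m - a) / 2))%R with (Rsqr (b / 2)) by (unfold Rsqr; nra).
  rewrite sqrt_Rsqr_abs. unfold Rdiv. rewrite Rabs_mult.
  rewrite (Rabs_pos_eq (/ 2)) by lra. reflexivity. }
assert (Hs := sqrt_sqrt _ Hp). assert (Ht := sqrt_sqrt _ Hn).
unfold Cmult; simpl. revert Hprod.
destruct (Rlt_dec b 0); [rewrite Rabs_left by lra | rewrite Rabs_pos_eq by lra];
  intro Hprod; f_equal; nra.
Qed.

Lemma phi_L_0 : phi_L 0 = 1.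
Proof.
unfold phi_L. rewrite Cplus_0_r. unfold Csqrt. rewrite Cmod_1. simpl.
replace ((1 + 1) / 2)%R with 1%R by lra. replace ((1 - 1) / 2)%R with 0%R by lra.
rewrite sqrt_1, sqrt_0, Rmult_0_r. reflexivity.
Qed.

Definition phi_Ne (z : C) : C := 1 + z - z ^ 3 / 3.

Definition class_SNe (f : C -> C) : Prop :=
  classA f /\ subordinate (star_quotient f) phi_Ne.

(* Gauss's limit n^x n! / (x (x+1) ... (x+n)), which defines Gamma at every
   real x outside {0, -1, -2, ...}, negative arguments included. *)
Definition Gamma (x : R) : R :=
  real (Lim_seq (fun n : nat =>
    (Rpower (INR n) x * INR (fact n) / prod_f_R0 (fun k => x + INR k) n)%R)).

Definition root_fun_L (beta : R) : R :=
  (3 / Gamma (- (1 / 2))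
     * Series (fun j : nat =>
         Gamma (- (1 / 2) + INR j) / (INR (fact j) * (1 + INR j * beta)))
   - 1)%R.

(* Main.v *)
Require Import Defs.
From Stdlib Require Import Reals Lra Lia Factorial.
From Coquelicot Require Import Coquelicot.

(** The function [p = z f' / f] solves [p + beta z p' = h] with
    [h = sqrt (1 + w)], and the Schwarz lemma gives
    [|h(z) - 1| <= 1 - sqrt (1 - |z|)].  Comparing with the solution [q] of
    [q + beta z q' = sqrt (1 + z)] along rays yields
    [|p(z) - 1| <= 1 - q(-|z|) < 1 - q(-1)], where
    [q(-1) = sum_j (-1/2)_j / (j! (1 + j beta))] increases with [beta] and equals
    [1/3] exactly at [beta_L].  So [p - 1] takes values in the disk of radius
    [2/3], on which [c = u - u^3/3] is inverted inside the unit disk by iterating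
    the contraction [u |-> c + u^3/3]; the inverse composed with [p - 1] is the
    Schwarz function required by [phi_Ne]. Its analyticity, and that of [p], comes
    from Cauchy's formula for functions with a continuous complex derivative. *)

Local Open Scope C_scope.

(** * Continuity and differentiability of complex-valued functions *)

(** The numbers 1/3 and 2/3 come from [phi_Ne]: on |u| = 1 one has |u - u^3/3| >= 1 - 1/3, with
    equality at u = -1, where [phi_Ne] equals 1/3. The disk of radius 2/3 is therefore the largest
    one about 1 inside the image of the unit disk, and q(-1) >= 1/3 is what keeps p in it. The
    function q is found term by term: q + beta z q' multiplies z^j by 1 + j beta, so each
    coefficient of sqrt (1 + z) is divided by that factor. In sqrt (1 - x) all coefficients after
    the constant one are negative; this sign, with a closed form for the partial sums, gives
    convergence at x = 1, monotonicity in beta and the strict inequality q(-|z|) > q(-1). Quotients,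
    composites and inverses are awkward for power series, so analyticity is exchanged for a
    continuous complex derivative, which these operations respect, and then recovered. Gamma enters
    only through quotients by its value at -1/2: a nonzero limit there suffices, and its value is
    never computed. *)

Definition CU : UniformSpace := AbsRing_UniformSpace C_AbsRing.

(** [C] carries two uniform structures, one by modulus and one by pairs of reals. Continuity uses
    the first, so that balls are [Cmod (x - z) < d] and the product rule for an absolute ring
    applies; series in [C_NormedModule] use the second. *)
Definition ccont {U : UniformSpace} (f : U -> C) (x : U) : Prop :=
  @continuous U CU f x.

Lemma ccontP {U : UniformSpace} (f : U -> C) (x : U) :
  ccont f x <->
  forall eps : posreal, locally x (fun y => (Cmod (f y - f x) < eps)%R).
Proof. exact (@filterlim_locally U CU (locally x) _ f (f x)). Qed.

Lemma locally_CU (z : C) (P : C -> Prop) :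
  @locally CU z P <->
  exists d : R, (0 < d)%R /\ forall x : C, (Cmod (x - z) < d)%R -> P x.
Proof.
split.
- intros [d Hd]. exists d. split; [apply cond_pos | exact Hd].
- intros [d [Hd H]]. exists (mkposreal d Hd). exact H.
Qed.

Lemma ccont_const {U : UniformSpace} (c : C) (x : U) : ccont (fun _ => c) x.
Proof. apply (@continuous_const U CU). Qed.

Lemma ccont_plus {U : UniformSpace} (f g : U -> C) (x : U) :
  ccont f x -> ccont g x -> ccont (fun y => f y + g y) x.
Proof.
exact (@continuous_plus U C_AbsRing (AbsRing_NormedModule C_AbsRing) f g x).
Qed.

Lemma ccont_mult {U : UniformSpace} (f g : U -> C) (x : U) :
  ccont f x -> ccont g x -> ccont (fun y => f y * g y) x.
Proof. exact (@continuous_mult U C_AbsRing f g x). Qed.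

Lemma ccont_opp {U : UniformSpace} (f : U -> C) (x : U) :
  ccont f x -> ccont (fun y => - f y) x.
Proof.
exact (@continuous_opp U C_AbsRing (AbsRing_NormedModule C_AbsRing) f x).
Qed.

Lemma ccont_minus {U : UniformSpace} (f g : U -> C) (x : U) :
  ccont f x -> ccont g x -> ccont (fun y => f y - g y) x.
Proof. intros Hf Hg. apply ccont_plus; [exact Hf | now apply ccont_opp]. Qed.

Lemma ccont_comp {U : UniformSpace} (g : U -> C) (f : C -> C) (x : U) :
  ccont g x -> @ccont CU f (g x) -> ccont (fun y => f (g y)) x.
Proof. exact (@continuous_comp U CU CU g f x). Qed.

Lemma ccont_pow {U : UniformSpace} (f : U -> C) (n : nat) (x : U) :
  ccont f x -> ccont (fun y => f y ^ n) x.
Proof.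
intros Hf. induction n as [|n IH]; [apply ccont_const | now apply ccont_mult].
Qed.

Lemma ccont_Re {U : UniformSpace} (f : U -> C) (x : U) :
  ccont f x -> @continuous U R_UniformSpace (fun y => Re (f y)) x.
Proof.
intros Hf. apply filterlim_locally. intros eps.
apply (filter_imp _ _) with (2 := proj1 (ccontP f x) Hf eps).
intros y Hy. apply Rle_lt_trans with (2 := Hy).
change (Rabs (Re (f y) - Re (f x)) <= Cmod (f y - f x))%R.
replace (Re (f y) - Re (f x))%R with (Re (f y - f x)) by reflexivity.
apply re_le_Cmod.
Qed.

Lemma im_le_Cmod (c : C) : (Rabs (Im c) <= Cmod c)%R.
Proof. eapply Rle_trans; [apply Rmax_r | apply Rmax_Cmod]. Qed.

Lemma ccont_Im {U : UniformSpace} (f : U -> C) (x : U) :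
  ccont f x -> @continuous U R_UniformSpace (fun y => Im (f y)) x.
Proof.
intros Hf. apply filterlim_locally. intros eps.
apply (filter_imp _ _) with (2 := proj1 (ccontP f x) Hf eps).
intros y Hy. apply Rle_lt_trans with (2 := Hy).
change (Rabs (Im (f y) - Im (f x)) <= Cmod (f y - f x))%R.
replace (Im (f y) - Im (f x))%R with (Im (f y - f x)) by reflexivity.
apply im_le_Cmod.
Qed.

Lemma Cmod_le_Rabs (c : C) : (Cmod c <= Rabs (Re c) + Rabs (Im c))%R.
Proof.
replace c with (RtoC (Re c) + Ci * RtoC (Im c)) at 1.
- eapply Rle_trans; [apply Cmod_triangle |].
  rewrite Cmod_mult, Cmod_Ci, !Cmod_R. lra.
- destruct c; unfold Cplus, Cmult, RtoC, Ci; simpl; f_equal; ring.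
Qed.

Lemma ccont_pair {U : UniformSpace} (u v : U -> R) (x : U) :
  @continuous U R_UniformSpace u x -> @continuous U R_UniformSpace v x ->
  ccont (fun y => (u y, v y)) x.
Proof.
intros Hu Hv. apply ccontP. intros eps.
assert (He : (0 < eps / 2)%R) by (destruct eps; simpl; lra).
assert (H1 := proj1 (filterlim_locally _ _) Hu (mkposreal _ He)).
assert (H2 := proj1 (filterlim_locally _ _) Hv (mkposreal _ He)).
apply (filter_imp _ _) with (2 := filter_and _ _ H1 H2).
intros y [Ha Hb].
eapply Rle_lt_trans; [apply Cmod_le_Rabs |].
change (Rabs (u y - u x) < eps / 2)%R in Ha.
change (Rabs (v y - v x) < eps / 2)%R in Hb.
change (Rabs (u y - u x) + Rabs (v y - v x) < eps)%R. lra.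
Qed.

Lemma ccont_RtoC (t : R) : @ccont R_UniformSpace RtoC t.
Proof. apply ccont_pair; [apply continuous_id | apply continuous_const]. Qed.

Lemma ccont_id (z : C) : @ccont CU (fun x => x) z.
Proof. apply (@continuous_id CU). Qed.

Lemma Cmod_minus_le (a b : C) : (Cmod a - Cmod b <= Cmod (a - b))%R.
Proof.
replace a with (a - b + b) at 1 by ring.
generalize (Cmod_triangle (a - b) b). lra.
Qed.

Lemma Cinv_ccont (z : C) : z <> 0 -> @ccont CU Cinv z.
Proof.
intros Hz. apply ccontP. intros eps. apply Cmod_gt_0 in Hz as Hm.
assert (He : (0 < eps)%R) by apply cond_pos.
set (m := Cmod z) in *.
apply locally_CU. exists (Rmin (m / 2) (eps * (m * m / 2))). split.
- apply Rmin_glb_lt; [lra |]. apply Rmult_lt_0_compat; [exact He | nra].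
- intros x Hx.
  assert (H1 := Rlt_le_trans _ _ _ Hx (Rmin_l _ _)).
  assert (H2 := Rlt_le_trans _ _ _ Hx (Rmin_r _ _)).
  assert (Hxm : (m / 2 < Cmod x)%R).
  { generalize (Cmod_minus_le z x). replace (z - x) with (- (x - z)) by ring.
    rewrite Cmod_opp. fold m. lra. }
  assert (Hx0 : x <> 0) by (apply Cmod_gt_0; lra).
  replace (/ x - / z) with (- (x - z) / (x * z)) by (field; auto).
  rewrite Cmod_div by (now apply Cmult_neq_0).
  rewrite Cmod_opp, Cmod_mult. fold m.
  apply Rmult_lt_reg_r with (Cmod x * m)%R; [nra |].
  unfold Rdiv. rewrite Rmult_assoc, Rinv_l, Rmult_1_r by nra.
  apply Rlt_le_trans with (1 := H2). apply Rmult_le_compat_l; nra.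
Qed.

Lemma ccont_inv {U : UniformSpace} (f : U -> C) (x : U) :
  ccont f x -> f x <> 0 -> ccont (fun y => / f y) x.
Proof. intros Hf H0. apply ccont_comp; [exact Hf | now apply Cinv_ccont]. Qed.

Lemma ccont_div {U : UniformSpace} (f g : U -> C) (x : U) :
  ccont f x -> ccont g x -> g x <> 0 -> ccont (fun y => f y / g y) x.
Proof. intros Hf Hg H0. apply ccont_mult; [exact Hf | now apply ccont_inv]. Qed.

(* Caratheodory's form of differentiability, with the increment of the variable
   read through [iota]: [iota = id] gives complex derivatives, [iota = RtoC]
   derivatives of curves. *)
Definition gderiv {U : UniformSpace} (iota g : U -> C) (t : U) (l : C) : Prop :=
  exists phi : U -> C,
    ccont phi t /\ phi t = l /\ forall s, g s - g t = (iota s - iota t) * phi s.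

Definition cderiv (f : C -> C) (z l : C) : Prop :=
  @gderiv CU (fun x => x) f z l.

Definition rderiv (g : R -> C) (t : R) (l : C) : Prop :=
  @gderiv R_UniformSpace RtoC g t l.

Section Caratheodory.

Context {U : UniformSpace} (iota : U -> C).
Hypothesis iota_cont : forall t, ccont iota t.

Lemma gderiv_cont (g : U -> C) (t : U) (l : C) :
  gderiv iota g t l -> ccont g t.
Proof.
intros [phi [Hc [_ H]]].
apply (@continuous_ext_loc U CU) with (fun s => g t + (iota s - iota t) * phi s).
- apply filter_forall. intros s. rewrite <- H. unfold Cminus.
  rewrite (Cplus_comm (g s)), Cplus_assoc, Cplus_opp_r, Cplus_0_l. reflexivity.
- apply ccont_plus; [apply ccont_const |].
  apply ccont_mult; [| exact Hc].
  apply ccont_minus; [apply iota_cont | apply ccont_const].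
Qed.

Lemma gderiv_const (c : C) (t : U) : gderiv iota (fun _ => c) t 0.
Proof.
exists (fun _ => 0). split; [apply ccont_const |]. split; [reflexivity |].
intros s. ring.
Qed.

Lemma gderiv_id (t : U) : gderiv iota iota t 1.
Proof.
exists (fun _ => 1). split; [apply ccont_const |]. split; [reflexivity |].
intros s. ring.
Qed.

Lemma gderiv_plus (f g : U -> C) (t : U) (l m : C) :
  gderiv iota f t l -> gderiv iota g t m ->
  gderiv iota (fun s => f s + g s) t (l + m).
Proof.
intros [phi [H1 [H2 H3]]] [psi [K1 [K2 K3]]].
exists (fun s => phi s + psi s). split; [now apply ccont_plus |].
split; [now rewrite H2, K2 |]. intros s.
replace (f s + g s - (f t + g t)) with (f s - f t + (g s - g t)) by ring.
rewrite H3, K3. ring.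
Qed.

Lemma gderiv_mult (f g : U -> C) (t : U) (l m : C) :
  gderiv iota f t l -> gderiv iota g t m ->
  gderiv iota (fun s => f s * g s) t (l * g t + f t * m).
Proof.
intros Hf Hg. assert (Hc := gderiv_cont _ _ _ Hg).
destruct Hf as [phi [H1 [H2 H3]]], Hg as [psi [K1 [K2 K3]]].
exists (fun s => phi s * g s + f t * psi s). split.
- apply ccont_plus; apply ccont_mult; trivial. apply ccont_const.
- split; [now rewrite H2, K2 |]. intros s.
  replace (f s * g s - f t * g t) with
    ((f s - f t) * g s + f t * (g s - g t)) by ring.
  rewrite H3, K3. ring.
Qed.

Lemma gderiv_comp (f : C -> C) (g : U -> C) (t : U) (l m : C) :
  cderiv f (g t) l -> gderiv iota g t m ->
  gderiv iota (fun s => f (g s)) t (l * m).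
Proof.
intros [phi [H1 [H2 H3]]] Hg. assert (Hc := gderiv_cont _ _ _ Hg).
destruct Hg as [psi [K1 [K2 K3]]].
exists (fun s => phi (g s) * psi s). split.
- apply ccont_mult; [now apply ccont_comp | exact K1].
- split; [now rewrite H2, K2 |]. intros s. rewrite H3, K3. ring.
Qed.

Lemma gderiv_scal (c : C) (g : U -> C) (t : U) (m : C) :
  gderiv iota g t m -> gderiv iota (fun s => c * g s) t (c * m).
Proof.
intros [psi [K1 [K2 K3]]]. exists (fun s => c * psi s). split.
- apply ccont_mult; [apply ccont_const | exact K1].
- split; [now rewrite K2 |]. intros s.
  replace (c * g s - c * g t) with (c * (g s - g t)) by ring. rewrite K3. ring.
Qed.

End Caratheodory.

Lemma cderiv_cont (f : C -> C) (z l : C) : cderiv f z l -> @ccont CU f z.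
Proof. apply (gderiv_cont (U := CU)). apply ccont_id. Qed.

(** Caratheodory's slope has to be defined on the whole plane. Outside the given neighbourhood the
    plain difference quotient serves as slope, and this does not affect continuity at [z]. *)
Lemma cderiv_local (f phi : C -> C) (z l : C) :
  @ccont CU phi z -> phi z = l ->
  @locally CU z (fun x => f x - f z = (x - z) * phi x) -> cderiv f z l.
Proof.
intros Hc Hl H. apply locally_CU in H. destruct H as [d [Hd H]].
exists (fun x => if Rlt_dec (Cmod (x - z)) d then phi x else (f x - f z) / (x - z)).
split; [| split].
- apply (@continuous_ext_loc CU CU) with phi; [| exact Hc].
  apply locally_CU. exists d. split; [exact Hd |]. intros x Hx.
  now destruct (Rlt_dec (Cmod (x - z)) d).
- destruct (Rlt_dec (Cmod (z - z)) d) as [_ | Hn]; [exact Hl |].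
  contradict Hn. replace (z - z) with (RtoC 0) by ring. now rewrite Cmod_0.
- intros x. destruct (Rlt_dec (Cmod (x - z)) d) as [Hx | Hn]; [now apply H |].
  field. intros E. apply Hn. rewrite E, Cmod_0. exact Hd.
Qed.

Lemma cderiv_ext_loc (f g : C -> C) (z l : C) :
  @locally CU z (fun x => f x = g x) -> cderiv f z l -> cderiv g z l.
Proof.
intros He [phi [H1 [H2 H3]]]. apply cderiv_local with phi; trivial.
apply (filter_imp _ _) with (2 := He). intros x Hx.
rewrite <- Hx, <- (locally_singleton _ _ He). apply H3.
Qed.

Lemma locally_neq_0 (z : C) : z <> 0 -> @locally CU z (fun x : C => x <> 0).
Proof.
intros Hz. apply locally_CU. exists (Cmod z). split; [now apply Cmod_gt_0 |].
intros x Hx E. subst x. replace (0 - z) with (- z) in Hx by ring.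
rewrite Cmod_opp in Hx. lra.
Qed.

Lemma cderiv_inv (z : C) : z <> 0 -> cderiv Cinv z (- / (z * z)).
Proof.
intros Hz. apply cderiv_local with (fun x => - / (x * z)); [| reflexivity |].
- apply (ccont_opp (U := CU) (fun x => / (x * z))), ccont_inv;
    [| now apply Cmult_neq_0].
  apply (ccont_mult (U := CU)); [apply ccont_id | apply ccont_const].
- apply (filter_imp _ _) with (2 := locally_neq_0 z Hz). intros x Hx.
  field. now split.
Qed.

Lemma cderiv_unique_C_derive (f : C -> C) (z l : C) :
  cderiv f z l -> C_derive f z = l.
Proof.
intros [phi [H1 [H2 H3]]]. apply is_C_lim_unique.
rewrite <- H2. intros P HP. apply locally_C in HP.
specialize (H1 P HP). apply locally_C in H1.
destruct H1 as [d Hd]. exists d. intros x Hx Hne. specialize (Hd x Hx).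
unfold filtermap.
rewrite H3. replace ((x - z) * phi x / (x - z)) with (phi x); [exact Hd |].
field. now apply Cminus_eq_contra.
Qed.

Lemma rderiv_Re (g : R -> C) (t : R) (l : C) :
  rderiv g t l -> is_derive (fun s => Re (g s)) t (Re l).
Proof.
intros [phi [H1 [H2 H3]]]. apply is_derive_Reals.
intros eps He.
destruct (proj1 (ccontP _ _) H1 (mkposreal eps He)) as [d Hd].
exists d. intros h Hh Hhd.
assert (Hb : @ball R_UniformSpace t d (t + h)%R).
{ change (Rabs (t + h - t) < d)%R. now replace (t + h - t)%R with h by ring. }
specialize (Hd _ Hb). simpl in Hd.
replace ((Re (g (t + h)) - Re (g t)) / h - Re l)%R
  with (Re (phi (t + h)%R - phi t)).
- eapply Rle_lt_trans; [apply re_le_Cmod | exact Hd].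
- replace (Re (g (t + h)%R) - Re (g t))%R with (Re (g (t + h)%R - g t)) by reflexivity.
  rewrite H3, <- RtoC_minus, re_scal_l, H2.
  change (Re (phi (t + h)%R - l)) with (Re (phi (t + h)%R) - Re l)%R.
  field. exact Hh.
Qed.

Lemma rderiv_Im (g : R -> C) (t : R) (l : C) :
  rderiv g t l -> is_derive (fun s => Im (g s)) t (Im l).
Proof.
(* Multiplication by [- Ci] turns the imaginary part into a real part. *)
intros H. apply (gderiv_scal (U := R_UniformSpace) RtoC (- Ci)) in H.
apply rderiv_Re in H.
replace (Im l) with (Re (- Ci * l)).
- apply is_derive_ext with (2 := H). intros s. destruct (g s) as [u v]. unfold Ci. simpl. ring.
- destruct l; unfold Ci. simpl. ring.
Qed.

Lemma rderiv_pair (u v : R -> R) (t a b : R) :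
  is_derive u t a -> is_derive v t b -> rderiv (fun s => (u s, v s)) t (a, b).
Proof.
assert (Hq : forall w c, is_derive w t c ->
  @continuous R_UniformSpace R_UniformSpace
    (fun s => if Req_EM_T s t then c else (w s - w t) / (s - t))%R t).
{ intros w c Hw. apply is_derive_Reals in Hw. apply filterlim_locally.
  intros eps. destruct (Hw eps (cond_pos eps)) as [d Hd].
  exists d. intros s Hs. change (Rabs (s - t) < d)%R in Hs.
  destruct (Req_EM_T t t) as [_ | Hn]; [| now contradiction Hn].
  destruct (Req_EM_T s t) as [E | Hn]; [apply ball_center |].
  assert (Hst : (s - t <> 0)%R) by lra.
  specialize (Hd _ Hst Hs). now rewrite (Rplus_minus t s) in Hd. }
intros Hu Hv.
exists (fun s => ((if Req_EM_T s t then a else (u s - u t) / (s - t))%R,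
                  (if Req_EM_T s t then b else (v s - v t) / (s - t))%R)).
split; [apply ccont_pair; now apply Hq | split].
- destruct (Req_EM_T t t) as [_ | Hn]; [reflexivity | now contradiction Hn].
- intros s. change R in s. rewrite <- RtoC_minus. unfold Cminus, Cplus, Copp, Cmult; simpl.
  destruct (Req_EM_T s t) as [E | Hn].
  + subst s. f_equal; ring.
  + f_equal; field; lra.
Qed.

(** * Complex power series *)

Definition cseries (u : nat -> C) (l : C) : Prop :=
  @is_series C_AbsRing C_NormedModule u l.

Lemma Re_sum_n (u : nat -> C) (n : nat) :
  Re (@sum_n C_NormedModule u n) = sum_n (fun k => Re (u k)) n.
Proof.
induction n as [|n IH]; [now rewrite !sum_O |].
rewrite !sum_Sn, <- IH. reflexivity.
Qed.

Lemma Im_sum_n (u : nat -> C) (n : nat) :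
  Im (@sum_n C_NormedModule u n) = sum_n (fun k => Im (u k)) n.
Proof.
induction n as [|n IH]; [now rewrite !sum_O |].
rewrite !sum_Sn, <- IH. reflexivity.
Qed.

Lemma cseriesP (u : nat -> C) (l : C) :
  cseries u l <->
  is_series (fun n => Re (u n)) (Re l) /\ is_series (fun n => Im (u n)) (Im l).
Proof.
split.
- intros H. split; apply filterlim_locally; intros eps;
    assert (Hb := proj1 (filterlim_locally _ _) H eps);
    apply (filter_imp _ _) with (2 := Hb); intros n [H1 H2].
  + rewrite <- Re_sum_n. exact H1.
  + rewrite <- Im_sum_n. exact H2.
- intros [H1 H2]. apply filterlim_locally. intros eps.
  assert (Hb := filter_and _ _ (proj1 (filterlim_locally _ _) H1 eps)
                               (proj1 (filterlim_locally _ _) H2 eps)).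
  apply (filter_imp _ _) with (2 := Hb). intros n [K1 K2].
  rewrite <- Re_sum_n in K1. rewrite <- Im_sum_n in K2. split; assumption.
Qed.

Lemma cseries_unique (u : nat -> C) (l m : C) :
  cseries u l -> cseries u m -> l = m.
Proof.
intros H K. apply cseriesP in H, K. destruct H as [H1 H2], K as [K1 K2].
apply is_series_unique in H1, H2, K1, K2.
destruct l, m; simpl in *. congruence.
Qed.

Lemma cseries_ext (u v : nat -> C) (l : C) :
  (forall n, u n = v n) -> cseries u l -> cseries v l.
Proof. apply is_series_ext. Qed.

Lemma cseries_scal (c : C) (u : nat -> C) (l : C) :
  cseries u l -> cseries (fun n => c * u n) (c * l).
Proof. exact (@is_series_scal C_AbsRing C_NormedModule c u l). Qed.

Lemma cseries_minus (u v : nat -> C) (l m : C) :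
  cseries u l -> cseries v m -> cseries (fun n => u n - v n) (l - m).
Proof. exact (@is_series_minus C_AbsRing C_NormedModule u v l m). Qed.

Lemma cseries_shift (u : nat -> C) (l : C) :
  cseries u l -> cseries (fun n => u (S n)) (l - u 0%nat).
Proof.
intros H. apply (@is_series_incr_1 C_AbsRing C_NormedModule).
match goal with |- is_series _ ?x => replace x with l end; [exact H |].
change (l = l - u 0%nat + u 0%nat). ring.
Qed.

Lemma is_psC (a : nat -> C) (x l : C) :
  @is_pseries C_AbsRing C_NormedModule a x l <-> cseries (fun n => a n * x ^ n) l.
Proof.
split; apply is_series_ext; intros n.
- exact (Cmult_comm (x ^ n) (a n)).
- exact (Cmult_comm (a n) (x ^ n)).
Qed.

Definition CSeries (u : nat -> C) : C :=
  (Series (fun n => Re (u n)), Series (fun n => Im (u n))).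

Lemma cseries_abs (u : nat -> C) :
  ex_series (fun n => Cmod (u n)) -> cseries u (CSeries u).
Proof.
intros H. apply cseriesP. split; apply Series_correct;
  apply (@ex_series_le R_AbsRing R_CompleteNormedModule) with (2 := H); intros n.
- apply re_le_Cmod.
- apply im_le_Cmod.
Qed.

Lemma cseries_bounded (u : nat -> C) (l : C) :
  cseries u l -> exists B, forall n, (Cmod (u n) <= B)%R.
Proof.
assert (Hr : forall v : nat -> R, ex_series v ->
  exists B, forall n, (Rabs (v n) <= B)%R).
{ intros v Hv. apply ex_series_lim_0, is_lim_seq_Reals in Hv.
  destruct (maj_by_pos v) as [B [_ HB]]; [exists 0%R; exact Hv |].
  now exists B. }
intros H. apply cseriesP in H. destruct H as [H1 H2].
destruct (Hr _ (ex_intro _ _ H1)) as [B1 HB1].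
destruct (Hr _ (ex_intro _ _ H2)) as [B2 HB2].
exists (B1 + B2)%R. intros n. eapply Rle_trans; [apply Cmod_le_Rabs |].
specialize (HB1 n). specialize (HB2 n). simpl in *. lra.
Qed.

(** Weierstrass M-test: past a suitable [N] both tails are below eps/4, and the finite head moves by
    less than eps/4 near [y]. *)
Lemma continuous_Series {U : UniformSpace} (g : nat -> U -> R) (M : nat -> R) (y : U) :
  ex_series M ->
  locally y (fun x => forall n, (Rabs (g n x) <= M n)%R) ->
  (forall n, @continuous U R_UniformSpace (g n) y) ->
  @continuous U R_UniformSpace (fun x => Series (fun n => g n x)) y.
Proof.
intros HM Hg Hc. apply filterlim_locally. intros eps.
assert (He : (0 < eps / 4)%R) by (destruct eps; simpl; lra).
destruct (proj1 (filterlim_locally _ _) (Series_correct _ HM) (mkposreal _ He))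
  as [N HN].
specialize (HN N (le_n N)). change (Rabs (sum_n M N - Series M) < eps / 4)%R in HN.
assert (HT : Series M = (sum_n M N + Series (fun k => M (S N + k)%nat))%R).
{ rewrite (Series_incr_n M (S N)); [| lia | exact HM].
  now rewrite sum_n_Reals. }
assert (Hex : forall x, (forall n, (Rabs (g n x) <= M n)%R) ->
  Series (fun n => g n x) =
    (sum_n (fun n => g n x) N + Series (fun k => g (S N + k)%nat x))%R /\
  (Rabs (Series (fun k => g (S N + k)%nat x)) < eps / 4)%R).
{ intros x Hx. split.
  - rewrite (Series_incr_n (fun n => g n x) (S N)); [| lia |].
    + now rewrite sum_n_Reals.
    + apply (@ex_series_le R_AbsRing R_CompleteNormedModule) with (2 := HM). exact Hx.
  - assert (HMs : ex_series (fun k => M (S N + k)%nat))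
      by (now apply (ex_series_incr_n M (S N))).
    eapply Rle_lt_trans; [apply Series_Rabs |].
    + apply (@ex_series_le R_AbsRing R_CompleteNormedModule) with (2 := HMs).
      intros k. unfold norm; simpl. unfold abs; simpl. rewrite Rabs_Rabsolu. apply Hx.
    + apply Rle_lt_trans with (Series (fun k => M (S N + k)%nat)).
      * apply Series_le; [| exact HMs]. intros k. split; [apply Rabs_pos | apply Hx].
      * apply Rabs_def2 in HN. lra. }
assert (Hs : @continuous U R_UniformSpace (fun x => sum_n (fun n => g n x) N) y).
{ clear - Hc. induction N as [|N IH].
  - apply continuous_ext with (g 0%nat); [intros x; now rewrite sum_O | apply Hc].
  - apply continuous_ext with (fun x => plus (sum_n (fun n => g n x) N) (g (S N) x)).
    + intros x. now rewrite sum_Sn.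
    + now apply (@continuous_plus U R_AbsRing R_NormedModule). }
assert (H1 := proj1 (filterlim_locally _ _) Hs (mkposreal _ He)).
apply (filter_imp _ _) with (2 := filter_and _ _ H1 Hg).
intros x [K1 K2].
change (Rabs (sum_n (fun n => g n x) N - sum_n (fun n => g n y) N) < eps / 4)%R in K1.
change (Rabs (Series (fun n => g n x) - Series (fun n => g n y)) < eps)%R.
destruct (Hex x K2) as [E1 L1]. destruct (Hex y (locally_singleton _ _ Hg)) as [E2 L2].
rewrite E1, E2. apply Rabs_def2 in K1, L1, L2. apply Rabs_def1; lra.
Qed.

Lemma ccont_CSeries {U : UniformSpace} (g : nat -> U -> C) (M : nat -> R) (y : U) :
  ex_series M ->
  locally y (fun x => forall n, (Cmod (g n x) <= M n)%R) ->
  (forall n, ccont (g n) y) ->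
  ccont (fun x => CSeries (fun n => g n x)) y.
Proof.
intros HM Hg Hc.
apply ccont_pair; apply continuous_Series with M; trivial.
- apply (filter_imp _ _) with (2 := Hg). intros x Hx n.
  eapply Rle_trans; [apply re_le_Cmod | apply Hx].
- intros n. now apply ccont_Re.
- apply (filter_imp _ _) with (2 := Hg). intros x Hx n.
  eapply Rle_trans; [apply im_le_Cmod | apply Hx].
- intros n. now apply ccont_Im.
Qed.

(** Convergence at the midpoint of [s] and [r] bounds the terms there, so the real series of moduli
    has radius of convergence beyond [s]; differentiation keeps that radius. *)
Lemma pseries_derive_abs (a : nat -> C) (r s : R) :
  (forall x, (Cmod x < r)%R -> exists l, cseries (fun n => a n * x ^ n) l) ->
  (0 <= s < r)%R ->
  ex_series (fun n => INR (S n) * Cmod (a (S n)) * s ^ n)%R.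
Proof.
intros H Hs.
set (b := fun n => Cmod (a n)).
assert (Hr : Rbar_lt (Rabs s) (CV_radius (PS_derive b))).
{ rewrite CV_radius_derive, Rabs_pos_eq by lra.
  apply Rbar_lt_le_trans with ((s + r) / 2)%R; [simpl; lra |].
  destruct (H (RtoC ((s + r) / 2))) as [l Hl].
  { rewrite Cmod_R, Rabs_pos_eq; lra. }
  apply cseries_bounded in Hl. destruct Hl as [B HB].
  apply (proj1 (CV_radius_bounded b)). exists B. intros n.
  specialize (HB n). rewrite <- RtoC_pow, Cmod_mult, Cmod_R in HB.
  rewrite Rabs_mult. unfold b. rewrite (Rabs_pos_eq (Cmod _)) by apply Cmod_ge_0.
  exact HB. }
apply CV_disk_inside in Hr.
apply ex_series_ext with (2 := Hr). intros n. unfold PS_derive, b.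
apply Rabs_pos_eq. apply Rmult_le_pos; [| apply pow_le; lra].
apply Rmult_le_pos; [apply pos_INR | apply Cmod_ge_0].
Qed.

(* [diffquot y n x] is sum_{k <= n} x^k y^(n-k), the divided difference of the
   (n+1)-st power. *)
Fixpoint diffquot (y : C) (n : nat) (x : C) : C :=
  match n with
  | O => 1
  | S m => x * diffquot y m x + y ^ n
  end.

Lemma diffquot_spec (y x : C) (n : nat) :
  x ^ S n - y ^ S n = (x - y) * diffquot y n x.
Proof.
induction n as [|n IH]; [simpl; ring |].
change (diffquot y (S n) x) with (x * diffquot y n x + y ^ S n).
replace ((x - y) * (x * diffquot y n x + y ^ S n))
  with (x * ((x - y) * diffquot y n x) + (x - y) * y ^ S n) by ring.
rewrite <- IH, (Cpow_S x (S n)), (Cpow_S y (S n)). ring.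
Qed.

Lemma diffquot_diag (y : C) (n : nat) :
  diffquot y n y = RtoC (INR (S n)) * y ^ n.
Proof.
induction n as [|n IH]; [simpl; ring |].
change (diffquot y (S n) y) with (y * diffquot y n y + y ^ S n).
rewrite IH, (S_INR (S n)), RtoC_plus, Cpow_S. ring.
Qed.

Lemma Cmod_diffquot_le (y x : C) (s : R) (n : nat) :
  (Cmod x <= s)%R -> (Cmod y <= s)%R ->
  (Cmod (diffquot y n x) <= INR (S n) * s ^ n)%R.
Proof.
intros Hx Hy. assert (Hs := Rle_trans _ _ _ (Cmod_ge_0 x) Hx).
induction n as [|n IH]; [simpl; rewrite Cmod_1; lra |].
change (diffquot y (S n) x) with (x * diffquot y n x + y ^ S n).
rewrite (S_INR (S n)). eapply Rle_trans; [apply Cmod_triangle |].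
rewrite Cmod_mult, Cmod_pow, Rmult_plus_distr_r.
apply Rplus_le_compat.
- apply Rle_trans with (s * (INR (S n) * s ^ n))%R; [| simpl; lra].
  apply Rmult_le_compat; trivial; apply Cmod_ge_0.
- rewrite Rmult_1_l. apply pow_incr. split; [apply Cmod_ge_0 | exact Hy].
Qed.

Lemma ccont_diffquot (y x : C) (n : nat) : @ccont CU (diffquot y n) x.
Proof.
induction n as [|n IH]; [apply ccont_const |].
apply (ccont_plus (U := CU) (fun x => x * diffquot y n x) (fun _ => y ^ S n)).
- apply (ccont_mult (U := CU) (fun x => x)); [apply ccont_id | exact IH].
- apply ccont_const.
Qed.

(** The slope at [y] is the series of [a (S n) * diffquot y n x], dominated by the moduli of the
    differentiated series at a radius [s] between |y| and [r]. The M-test makes it continuous in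
    [x], and on the diagonal it is the termwise derivative. *)
Lemma cderiv_pseries (a : nat -> C) (r : R) (f : C -> C) (y : C) :
  (forall x, (Cmod x < r)%R -> cseries (fun n => a n * x ^ n) (f x)) ->
  (Cmod y < r)%R ->
  exists l, cderiv f y l /\
    cseries (fun n => RtoC (INR (S n)) * a (S n) * y ^ n) l.
Proof.
intros Hf Hy.
set (s := ((Cmod y + r) / 2)%R).
assert (Hys : (Cmod y < s < r)%R) by (unfold s; lra).
assert (Hy0 := Cmod_ge_0 y).
assert (HM : ex_series (fun n => INR (S n) * Cmod (a (S n)) * s ^ n)%R).
{ apply pseries_derive_abs with r; [| lra]. intros x Hx. exists (f x). now apply Hf. }
assert (Hb : forall x, (Cmod x <= s)%R -> forall n,
  (Cmod (a (S n) * diffquot y n x) <= INR (S n) * Cmod (a (S n)) * s ^ n)%R).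
{ intros x Hx n. rewrite Cmod_mult.
  replace (INR (S n) * Cmod (a (S n)) * s ^ n)%R
    with (Cmod (a (S n)) * (INR (S n) * s ^ n))%R by ring.
  apply Rmult_le_compat_l; [apply Cmod_ge_0 |].
  apply Cmod_diffquot_le; lra. }
assert (Hser : forall x, (Cmod x <= s)%R ->
  cseries (fun n => a (S n) * diffquot y n x)
          (CSeries (fun n => a (S n) * diffquot y n x))).
{ intros x Hx. apply cseries_abs.
  apply (@ex_series_le R_AbsRing R_CompleteNormedModule) with (2 := HM).
  intros n. unfold norm; simpl. unfold abs; simpl.
  rewrite Rabs_pos_eq by apply Cmod_ge_0. now apply Hb. }
exists (CSeries (fun n => a (S n) * diffquot y n y)). split.
- assert (Hloc : @locally CU y (fun x : C => (Cmod x <= s)%R)).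
  { apply locally_CU. exists (s - Cmod y)%R. split; [lra |]. intros x Hx.
    generalize (Cmod_minus_le x y). lra. }
  apply cderiv_local with (fun x => CSeries (fun n => a (S n) * diffquot y n x));
    [| reflexivity |].
  + apply (ccont_CSeries (U := CU)) with (1 := HM).
    * apply (filter_imp _ _) with (2 := Hloc). exact Hb.
    * intros n. apply (ccont_mult (U := CU) (fun _ => a (S n)));
        [apply ccont_const | apply ccont_diffquot].
  + apply (filter_imp _ _) with (2 := Hloc). intros x Hx.
    apply cseries_unique with (fun n => a (S n) * x ^ S n - a (S n) * y ^ S n).
    * assert (H1 := cseries_shift _ _ (Hf x ltac:(lra))).
      assert (H2 := cseries_shift _ _ (Hf y ltac:(lra))).
      assert (H := cseries_minus _ _ _ _ H1 H2). simpl (_ ^ 0) in H.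
      replace (f x - f y) with (f x - a 0%nat * 1 - (f y - a 0%nat * 1)) by ring.
      exact H.
    * apply cseries_ext with (2 := cseries_scal (x - y) _ _ (Hser x Hx)).
      intros n. replace (a (S n) * x ^ S n - a (S n) * y ^ S n)
        with (a (S n) * (x ^ S n - y ^ S n)) by ring.
      rewrite diffquot_spec. ring.
- apply cseries_ext with (2 := Hser y ltac:(lra)). intros n.
  rewrite diffquot_diag. ring.
Qed.

(** * Integrals over the unit circle *)

Definition rcont (g : R -> C) : Prop := forall t, @ccont R_UniformSpace g t.

Definition CInt (g : R -> C) : C :=
  (RInt (fun t => Re (g t)) 0 (2 * PI), RInt (fun t => Im (g t)) 0 (2 * PI)).

Lemma ex_RInt_Re (g : R -> C) (a b : R) :
  rcont g -> ex_RInt (fun t => Re (g t)) a b.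
Proof.
intros Hg. apply (@ex_RInt_continuous R_CompleteNormedModule).
intros t _. now apply ccont_Re.
Qed.

Lemma ex_RInt_Im (g : R -> C) (a b : R) :
  rcont g -> ex_RInt (fun t => Im (g t)) a b.
Proof.
intros Hg. apply (@ex_RInt_continuous R_CompleteNormedModule).
intros t _. now apply ccont_Im.
Qed.

Lemma CInt_ext (f g : R -> C) : (forall t, f t = g t) -> CInt f = CInt g.
Proof.
intros H. unfold CInt. f_equal; apply RInt_ext; intros t _; now rewrite H.
Qed.

Lemma CInt_plus (f g : R -> C) :
  rcont f -> rcont g -> CInt (fun t => f t + g t) = CInt f + CInt g.
Proof.
intros Hf Hg. unfold CInt, Cplus at 3; simpl. f_equal.
- apply (@RInt_plus R_CompleteNormedModule); now apply ex_RInt_Re.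
- apply (@RInt_plus R_CompleteNormedModule); now apply ex_RInt_Im.
Qed.

Lemma CInt_scal (c : C) (g : R -> C) :
  rcont g -> CInt (fun t => c * g t) = c * CInt g.
Proof.
intros Hg. assert (H1 := fun a b => ex_RInt_Re g a b Hg).
assert (H2 := fun a b => ex_RInt_Im g a b Hg).
assert (S : forall (k : R) (u : R -> R), ex_RInt u 0 (2 * PI) ->
  is_RInt (fun t => (k * u t)%R) 0 (2 * PI) (k * RInt u 0 (2 * PI))%R).
{ intros k u Hu. apply (@is_RInt_scal R_NormedModule), (@RInt_correct R_CompleteNormedModule), Hu. }
destruct c as [a b]. unfold CInt. unfold Cmult at 3; simpl. f_equal.
- apply is_RInt_unique.
  apply (@is_RInt_minus R_NormedModule); apply S; [apply H1 | apply H2].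
- apply is_RInt_unique.
  apply (@is_RInt_plus R_NormedModule); apply S; [apply H2 | apply H1].
Qed.

(** Real and imaginary parts are bounded separately, hence 4 PI in place of the optimal 2 PI. The
    lost factor is harmless for convergence and is removed in the maximum principle by taking
    powers. *)
Lemma Cmod_CInt_le (g : R -> C) (M : R) :
  rcont g -> (forall t, (0 <= t <= 2 * PI)%R -> (Cmod (g t) <= M)%R) ->
  (Cmod (CInt g) <= 4 * PI * M)%R.
Proof.
intros Hg HM. assert (Hpi := PI_RGT_0).
eapply Rle_trans; [apply Cmod_le_Rabs |].
replace (4 * PI * M)%R with ((2 * PI - 0) * M + (2 * PI - 0) * M)%R by ring.
apply Rplus_le_compat; simpl.
- apply abs_RInt_le_const; [lra | now apply ex_RInt_Re |].
  intros t Ht. eapply Rle_trans; [apply re_le_Cmod | now apply HM].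
- apply abs_RInt_le_const; [lra | now apply ex_RInt_Im |].
  intros t Ht. eapply Rle_trans; [apply im_le_Cmod | now apply HM].
Qed.

Lemma CInt_derive (g g' : R -> C) :
  (forall t, rderiv g t (g' t)) -> rcont g' -> g (2 * PI)%R = g 0%R -> CInt g' = 0.
Proof.
intros Hd Hc Hp. unfold CInt, RtoC. f_equal; apply is_RInt_unique.
- replace 0%R with (Re (g (2 * PI)%R) - Re (g 0%R))%R at 2 by (rewrite Hp; ring).
  apply (@is_RInt_derive R_CompleteNormedModule (fun t => Re (g t))).
  + intros t _. now apply rderiv_Re.
  + intros t _. now apply ccont_Re.
- replace 0%R with (Im (g (2 * PI)%R) - Im (g 0%R))%R at 2 by (rewrite Hp; ring).
  apply (@is_RInt_derive R_CompleteNormedModule (fun t => Im (g t))).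
  + intros t _. now apply rderiv_Im.
  + intros t _. now apply ccont_Im.
Qed.

Lemma rcont_bounded (g : R -> C) (a b : R) :
  rcont g -> exists M, (0 <= M)%R /\ forall t, (a <= t <= b)%R -> (Cmod (g t) <= M)%R.
Proof.
intros Hg.
destruct (@bounded_continuity R_AbsRing R_NormedModule (fun t => Re (g t)) a b) as [M1 H1].
{ intros t _. now apply ccont_Re. }
destruct (@bounded_continuity R_AbsRing R_NormedModule (fun t => Im (g t)) a b) as [M2 H2].
{ intros t _. now apply ccont_Im. }
exists (Rmax 0 (M1 + M2)). split; [apply Rmax_l |]. intros t Ht.
apply Rle_trans with (2 := Rmax_r _ _).
eapply Rle_trans; [apply Cmod_le_Rabs |].
specialize (H1 t Ht). specialize (H2 t Ht).
apply Rplus_le_compat; now apply Rlt_le.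
Qed.

Definition cis (t : R) : C := (cos t, sin t).

Lemma Cmod_cis (t : R) : Cmod (cis t) = 1%R.
Proof.
unfold Cmod, cis. simpl fst. simpl snd.
replace (cos t ^ 2 + sin t ^ 2)%R with 1%R; [apply sqrt_1 |].
rewrite <- (sin2_cos2 t). unfold Rsqr. ring.
Qed.

Lemma cis_neq_0 (t : R) : cis t <> 0.
Proof. apply Cmod_gt_0. rewrite Cmod_cis. lra. Qed.

Lemma cis_plus (s t : R) : cis (s + t) = cis s * cis t.
Proof.
unfold cis, Cmult; simpl. rewrite cos_plus, sin_plus. f_equal; ring.
Qed.

Lemma cis_0 : cis 0 = 1.
Proof. unfold cis. now rewrite cos_0, sin_0. Qed.

Lemma Cinv_cis_pow (t : R) (n : nat) : (/ cis t) ^ n = cis (- INR n * t).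
Proof.
assert (H := cis_neq_0 t).
assert (Hinv : / cis t = cis (- t)).
{ replace (/ cis t) with (/ cis t * cis (t + - t)).
  - rewrite cis_plus. field. exact H.
  - rewrite Rplus_opp_r, cis_0. ring. }
induction n as [|n IH].
- replace (- INR 0 * t)%R with 0%R by (simpl; ring). now rewrite cis_0.
- rewrite Cpow_S, IH, Hinv, <- cis_plus. f_equal. rewrite S_INR. ring.
Qed.

Lemma rderiv_cis (k t : R) :
  rderiv (fun s => cis (k * s)) t (Ci * RtoC k * cis (k * t)).
Proof.
replace (Ci * RtoC k * cis (k * t)) with ((- (k * sin (k * t)))%R, (k * cos (k * t))%R).
- apply rderiv_pair; auto_derive; trivial; ring.
- unfold cis, Ci, Cmult, RtoC; simpl. f_equal; ring.
Qed.

Lemma rcont_cis : rcont cis.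
Proof.
intros t. apply (gderiv_cont (U := R_UniformSpace) RtoC) with (l := Ci * RtoC 1 * cis (1 * t)).
- apply ccont_RtoC.
- destruct (rderiv_cis 1 t) as [phi [H1 [H2 H3]]].
  exists phi. split; [exact H1 |]. split; [exact H2 |].
  intros s. generalize (H3 s). now rewrite !Rmult_1_l.
Qed.

Lemma cis_2PI (n : nat) : cis (- INR n * (2 * PI)) = cis (- INR n * 0).
Proof.
rewrite Rmult_0_r, cis_0, <- Cinv_cis_pow.
replace (cis (2 * PI)) with (RtoC 1).
- replace (/ 1) with (RtoC 1) by (field; exact C1_nz). now rewrite Cpow_1_l.
- unfold cis. now rewrite cos_2PI, sin_2PI.
Qed.

Lemma rcont_inv_cis_pow (n : nat) : rcont (fun t => (/ cis t) ^ n).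
Proof.
intros t. apply ccont_pow, ccont_inv; [apply rcont_cis | apply cis_neq_0].
Qed.

Lemma CInt_inv_cis_pow (n : nat) :
  CInt (fun t => (/ cis t) ^ S n) = 0.
Proof.
assert (Hk : Ci * RtoC (- INR (S n)) <> 0).
{ apply Cmult_neq_0; [exact Ci_nz |]. apply Cmod_gt_0.
  rewrite Cmod_R, Rabs_Ropp. apply Rabs_pos_lt. apply not_0_INR. lia. }
apply CInt_derive with
  (fun t => / (Ci * RtoC (- INR (S n))) * cis (- INR (S n) * t)).
- intros t.
  replace ((/ cis t) ^ S n) with
    (/ (Ci * RtoC (- INR (S n))) * (Ci * RtoC (- INR (S n)) * cis (- INR (S n) * t))).
  + apply gderiv_scal, rderiv_cis.
  + rewrite Cinv_cis_pow, Cmult_assoc, Cinv_l, Cmult_1_l by exact Hk. reflexivity.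
- apply rcont_inv_cis_pow.
- now rewrite cis_2PI.
Qed.

Lemma CInt_one : CInt (fun _ => 1) = RtoC (2 * PI).
Proof.
unfold CInt, RtoC. rewrite !RInt_const. f_equal; unfold scal; simpl; unfold mult; simpl; ring.
Qed.

Lemma cseries_of_remainder (u : nat -> C) (l : C) (B q : R) :
  (0 <= q < 1)%R ->
  (forall n, (Cmod (@sum_n C_NormedModule u n - l) <= B * q ^ n)%R) ->
  cseries u l.
Proof.
intros Hq H.
assert (Hl : is_lim_seq (fun n => (B * q ^ n)%R) 0).
{ replace (Finite 0) with (Rbar_mult B 0) by (simpl; now rewrite Rmult_0_r).
  apply is_lim_seq_scal_l, is_lim_seq_geom. rewrite Rabs_pos_eq; lra. }
assert (S : forall (v : nat -> R) (m : R),
  (forall n, (Rabs (sum_n v n - m) <= B * q ^ n)%R) -> is_series v m).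
{ intros v m Hv. change (is_lim_seq (sum_n v) m).
  apply is_lim_seq_ext with (fun n => ((sum_n v n - m) + m)%R); [intros n; ring |].
  replace (Finite m) with (Rbar_plus 0 m) by (simpl; f_equal; ring).
  apply is_lim_seq_plus'; [| apply is_lim_seq_const].
  apply is_lim_seq_abs_0.
  apply is_lim_seq_le_le with (fun _ => 0%R) (fun n => (B * q ^ n)%R); trivial.
  - intros n. split; [apply Rabs_pos | apply Hv].
  - apply is_lim_seq_const. }
apply cseriesP. split; apply S; intros n; eapply Rle_trans; try apply (H n).
- rewrite <- Re_sum_n. apply (re_le_Cmod (_ - l)).
- rewrite <- Im_sum_n. apply (im_le_Cmod (_ - l)).
Qed.

Lemma Cminus_div_cis_neq_0 (x : C) (t : R) :
  (Cmod x < 1)%R -> (1 - Cmod x <= Cmod (1 - x / cis t))%R /\ 1 - x / cis t <> 0.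
Proof.
intros Hx.
assert (H : (1 - Cmod x <= Cmod (1 - x / cis t))%R).
{ generalize (Cmod_minus_le 1 (x / cis t)).
  rewrite Cmod_1, Cmod_div, Cmod_cis by apply cis_neq_0. lra. }
split; [exact H |]. apply Cmod_gt_0. lra.
Qed.

Lemma rcont_kernel (x : C) (n : nat) (F : R -> C) :
  (Cmod x < 1)%R -> rcont F ->
  rcont (fun t => F t * (/ cis t) ^ n / (1 - x / cis t)).
Proof.
intros Hx HF t. apply ccont_div.
- apply ccont_mult; [apply HF | apply rcont_inv_cis_pow].
- apply ccont_minus; [apply ccont_const |].
  apply ccont_div; [apply ccont_const | apply rcont_cis | apply cis_neq_0].
- now apply Cminus_div_cis_neq_0.
Qed.

(** With q = x / cis t, the identity 1/(1 - q) = 1 + q/(1 - q) gives a recursion between the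
    integrals [J n]. Iterating it leaves the exact remainder x^(n+1) [J (S n)]; since [J] is
    bounded, no exchange of sum and integral is required. *)
Lemma Cauchy_kernel_series (F : R -> C) (x : C) :
  rcont F -> (Cmod x < 1)%R ->
  cseries (fun n => CInt (fun t => F t * (/ cis t) ^ n) * x ^ n)
          (CInt (fun t => F t / (1 - x / cis t))).
Proof.
intros HF Hx.
destruct (rcont_bounded F 0 (2 * PI) HF) as [M [HM0 HM]].
set (J := fun n => CInt (fun t => F t * (/ cis t) ^ n / (1 - x / cis t))).
assert (HJ : forall n, J n = CInt (fun t => F t * (/ cis t) ^ n) + x * J (S n)).
{ intros n. unfold J. rewrite <- CInt_scal by now apply rcont_kernel.
  rewrite <- CInt_plus.
  - apply CInt_ext. intros t. assert (H1 := cis_neq_0 t).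
    destruct (Cminus_div_cis_neq_0 x t Hx) as [_ H2].
    rewrite Cpow_S. field. split; [exact H1 |].
    intros E. apply H2.
    replace (1 - x / cis t) with ((cis t - x) / cis t) by (field; exact H1).
    rewrite E. field. exact H1.
  - intros t. apply ccont_mult; [apply HF | apply rcont_inv_cis_pow].
  - intros t. apply ccont_mult; [apply ccont_const |].
    now apply (rcont_kernel x (S n) F). }
assert (Hb : forall n, (Cmod (J n) <= 4 * PI * (M / (1 - Cmod x)))%R).
{ intros n. apply Cmod_CInt_le; [now apply rcont_kernel |]. intros t Ht.
  destruct (Cminus_div_cis_neq_0 x t Hx) as [H1 H2].
  rewrite Cmod_div, Cmod_mult, Cmod_pow, Cmod_inv, Cmod_cis, Rinv_1, pow1, Rmult_1_r
    by (trivial; apply cis_neq_0).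
  unfold Rdiv. apply Rmult_le_compat; [apply Cmod_ge_0 | | now apply HM |].
  - apply Rlt_le, Rinv_0_lt_compat. lra.
  - apply Rinv_le_contravar; lra. }
assert (HJ0 : CInt (fun t => F t / (1 - x / cis t)) = J 0%nat).
{ apply CInt_ext. intros t. simpl. unfold Cdiv. ring. }
assert (Hs : forall n, J 0%nat =
  @sum_n C_NormedModule (fun k => CInt (fun t => F t * (/ cis t) ^ k) * x ^ k) n
    + x ^ S n * J (S n)).
{ induction n as [|n IH].
  - rewrite sum_O, HJ, (Cpow_1_r x). simpl. ring.
  - rewrite sum_Sn, IH, (HJ (S n)).
    match goal with |- ?W + _ * (?A + _) = plus _ ?B + _ =>
      change (W + x ^ S n * (A + x * J (S (S n))) = W + B + x ^ S (S n) * J (S (S n))) end.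
    rewrite (Cpow_S x (S n)). ring. }
rewrite HJ0.
assert (Hx0 := Cmod_ge_0 x).
apply cseries_of_remainder with (4 * PI * (M / (1 - Cmod x)))%R (Cmod x); [lra |].
intros n. rewrite (Hs n).
match goal with |- (Cmod (?S - (?T + ?A * ?B)) <= _)%R =>
  replace (S - (T + A * B)) with (- (A * B)) by (change S with T; ring) end.
rewrite Cmod_opp, Cmod_mult, Cmod_pow, (Rmult_comm (4 * PI * _)).
apply Rmult_le_compat; [apply pow_le; lra | apply Cmod_ge_0 | | apply Hb].
change (Cmod x * Cmod x ^ n <= Cmod x ^ n)%R.
rewrite <- (Rmult_1_l (Cmod x ^ n)) at 2. apply Rmult_le_compat_r; [apply pow_le |]; lra.
Qed.

(** In the expansion of the kernel for the constant function 1 all terms but the first integrate to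
    0, so every partial sum already equals 2 PI and the remainder bound is 0. *)
Lemma CInt_Cauchy_kernel (x : C) :
  (Cmod x < 1)%R -> CInt (fun t => 1 / (1 - x / cis t)) = RtoC (2 * PI).
Proof.
intros Hx.
apply cseries_unique with (1 := Cauchy_kernel_series (fun _ => 1) x (fun t => ccont_const _ _) Hx).
assert (H0 : forall n, CInt (fun t => 1 * (/ cis t) ^ S n) * x ^ S n = 0).
{ intros n. rewrite (CInt_ext _ (fun t => (/ cis t) ^ S n)) by (intros t; ring).
  rewrite CInt_inv_cis_pow. ring. }
apply cseries_of_remainder with 0%R 0%R; [lra |]. intros n.
match goal with |- (Cmod ?c <= _)%R => replace c with (RtoC 0) end;
  [rewrite Cmod_0; lra |].
symmetry. apply -> Ceq_minus. induction n as [|n IH].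
- rewrite sum_O, (CInt_ext _ (fun t => 1)) by (intros t; simpl; ring).
  rewrite CInt_one. simpl. ring.
- rewrite sum_Sn, H0, IH. apply (Cplus_0_r (RtoC (2 * PI))).
Qed.

(** * Cauchy's formula and analyticity *)

Section Cauchy.

Variables (F F' : C -> C) (r : R) (x : C).
Hypothesis r_gt1 : (1 < r)%R.
Hypothesis F_diff : forall y, (Cmod y < r)%R -> cderiv F y (F' y) /\ @ccont CU F' y.
Hypothesis x_lt1 : (Cmod x < 1)%R.

Let path (s t : R) : C := x + RtoC s * (cis t - x).

(** The parameter may leave [0, 1] by (r - 1)/4 on either side, so that two-sided derivatives exist
    at the end points; there |1 - s| + |s| stays below 1 + (r - 1)/2 < r. *)
Let path_lt_r (s t : R) :
  (- ((r - 1) / 4) < s < 1 + (r - 1) / 4)%R -> (Cmod (path s t) < r)%R.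
Proof.
intros Hs. unfold path.
replace (x + RtoC s * (cis t - x)) with (RtoC (1 - s) * x + RtoC s * cis t)
  by (rewrite RtoC_minus; ring).
eapply Rle_lt_trans; [apply Cmod_triangle |].
rewrite !Cmod_mult, !Cmod_R, Cmod_cis, Rmult_1_r.
apply Rle_lt_trans with (Rabs (1 - s) + Rabs s)%R.
- apply Rplus_le_compat_r. rewrite <- (Rmult_1_r (Rabs (1 - s))) at 2.
  apply Rmult_le_compat_l; [apply Rabs_pos | lra].
- unfold Rabs. destruct (Rcase_abs (1 - s)), (Rcase_abs s); lra.
Qed.

Let kern (s t : R) : C := F (path s t) / (1 - x / cis t).

(** This is the [s]-derivative of [kern]: the inner derivative [cis t - x] equals cis t (1 - x / cis
    t), which cancels the denominator. *)
Let dkern (s t : R) : C := F' (path s t) * cis t.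

Let path_rderiv_s (s t : R) : rderiv (fun u => path u t) s (cis t - x).
Proof.
replace (cis t - x) with (0 + (1 * (cis t - x) + RtoC s * 0)) by ring.
apply (gderiv_plus (U := R_UniformSpace)); [apply gderiv_const |].
apply (gderiv_mult (U := R_UniformSpace) RtoC ccont_RtoC RtoC (fun _ => cis t - x));
  [apply (gderiv_id (U := R_UniformSpace) RtoC) | apply gderiv_const].
Qed.

Let path_rderiv_t (s t : R) : rderiv (fun u => path s u) t (RtoC s * (Ci * cis t)).
Proof.
replace (RtoC s * (Ci * cis t)) with (0 + RtoC s * (Ci * RtoC 1 * cis (1 * t) + 0))
  by (rewrite Rmult_1_l; ring).
apply (gderiv_plus (U := R_UniformSpace)); [apply gderiv_const |].
apply (gderiv_scal (U := R_UniformSpace)).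
destruct (gderiv_plus (U := R_UniformSpace) RtoC _ _ _ _ _ (rderiv_cis 1 t)
  (gderiv_const (U := R_UniformSpace) RtoC (- x) t)) as [phi [H1 [H2 H3]]].
exists phi. split; [exact H1 |]. split; [exact H2 |].
intros u. generalize (H3 u). now rewrite !Rmult_1_l.
Qed.

Let kern_rderiv (s t : R) :
  (- ((r - 1) / 4) < s < 1 + (r - 1) / 4)%R ->
  rderiv (fun u => kern u t) s (dkern s t).
Proof.
intros Hs. unfold kern, dkern.
destruct (Cminus_div_cis_neq_0 x t x_lt1) as [_ Hn]. assert (Hc := cis_neq_0 t).
replace (F' (path s t) * cis t)
  with (F' (path s t) * (cis t - x) * / (1 - x / cis t) + F (path s t) * 0).
- apply (gderiv_mult (U := R_UniformSpace) RtoC ccont_RtoC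
           (fun u => F (path u t)) (fun _ => / (1 - x / cis t))).
  + apply (gderiv_comp (U := R_UniformSpace) RtoC ccont_RtoC).
    * now apply F_diff, path_lt_r.
    * apply path_rderiv_s.
  + apply gderiv_const.
- field. split; [exact Hc |]. intros E. apply Hn.
  replace (1 - x / cis t) with ((cis t - x) / cis t) by (field; exact Hc).
  rewrite E. field. exact Hc.
Qed.

Let path_ccont2 (s t : R) :
  @ccont (prod_UniformSpace R_UniformSpace R_UniformSpace)
    (fun p => path (fst p) (snd p)) (s, t).
Proof.
assert (H1 : @ccont (prod_UniformSpace R_UniformSpace R_UniformSpace)
               (fun p => RtoC (fst p)) (s, t)).
{ apply (@continuous_comp _ R_UniformSpace CU fst RtoC);
    [apply continuous_fst | apply ccont_RtoC]. }
assert (H2 : @ccont (prod_UniformSpace R_UniformSpace R_UniformSpace)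
               (fun p => cis (snd p)) (s, t)).
{ apply (@continuous_comp _ R_UniformSpace CU snd cis);
    [apply continuous_snd | apply rcont_cis]. }
apply ccont_plus; [apply ccont_const |]. apply ccont_mult; [exact H1 |].
apply ccont_minus; [exact H2 | apply ccont_const].
Qed.

(** Continuity in both parameters jointly is what differentiation under the integral sign asks
    for. *)
Let dkern_ccont2 (s t : R) :
  (- ((r - 1) / 4) < s < 1 + (r - 1) / 4)%R ->
  @ccont (prod_UniformSpace R_UniformSpace R_UniformSpace)
    (fun p => dkern (fst p) (snd p)) (s, t).
Proof.
intros Hs. apply ccont_mult.
- apply (ccont_comp (fun p => path (fst p) (snd p)) F').
  + apply path_ccont2.
  + now apply F_diff, path_lt_r.
- apply (@continuous_comp _ R_UniformSpace CU snd cis);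
    [apply continuous_snd | apply rcont_cis].
Qed.

Let kern_rcont (s : R) :
  (- ((r - 1) / 4) < s < 1 + (r - 1) / 4)%R -> rcont (kern s).
Proof.
intros Hs t. apply ccont_div.
- apply (ccont_comp (fun t => path s t) F).
  + apply (gderiv_cont (U := R_UniformSpace) RtoC ccont_RtoC) with (1 := path_rderiv_t s t).
  + apply cderiv_cont with (F' (path s t)). now apply F_diff, path_lt_r.
- apply ccont_minus; [apply ccont_const |].
  apply ccont_div; [apply ccont_const | apply rcont_cis | apply cis_neq_0].
- now apply Cminus_div_cis_neq_0.
Qed.

Let dkern_rcont (s : R) :
  (- ((r - 1) / 4) < s < 1 + (r - 1) / 4)%R -> rcont (dkern s).
Proof.
intros Hs t. apply ccont_mult; [| apply rcont_cis].
apply (ccont_comp (fun t => path s t) F').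
- apply (gderiv_cont (U := R_UniformSpace) RtoC ccont_RtoC) with (1 := path_rderiv_t s t).
- now apply F_diff, path_lt_r.
Qed.

(* [dkern s t = F' (path s t) * cis t] is, up to the factor [s * Ci], the
   [t]-derivative of the periodic function [F (path s t)]. *)
Let CInt_dkern (s : R) :
  (0 < s < 1 + (r - 1) / 4)%R -> CInt (dkern s) = 0.
Proof.
intros Hs. assert (Hs0 : RtoC s <> 0) by (intros E; apply RtoC_inj in E; lra).
apply CInt_derive with (fun t => / (RtoC s * Ci) * F (path s t)).
- intros t. replace (dkern s t)
    with (/ (RtoC s * Ci) * (F' (path s t) * (RtoC s * (Ci * cis t)))).
  + apply gderiv_scal, (gderiv_comp (U := R_UniformSpace) RtoC ccont_RtoC).
    * apply F_diff, path_lt_r. lra.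
    * apply path_rderiv_t.
  + unfold dkern. field. split; [exact Ci_nz | exact Hs0].
- apply dkern_rcont. lra.
- unfold path. f_equal. f_equal. f_equal. f_equal. f_equal.
  unfold cis. now rewrite cos_2PI, sin_2PI, cos_0, sin_0.
Qed.

(* Shrinking the circle to [x] along the segments [path] leaves the integral
   unchanged. *)
Lemma Cauchy_homotopy_Re :
  RInt (fun t => Re (F (cis t) / (1 - x / cis t))) 0 (2 * PI) =
  RInt (fun t => Re (F x / (1 - x / cis t))) 0 (2 * PI).
Proof.
set (Phi := fun s => RInt (fun t => Re (kern s t)) 0 (2 * PI)).
assert (Hd : forall s, (- ((r - 1) / 4) < s < 1 + (r - 1) / 4)%R ->
  is_derive Phi s (RInt (fun t => Re (dkern s t)) 0 (2 * PI))).
{ intros s Hs.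
  assert (Hloc : @locally R_UniformSpace s
            (fun u => - ((r - 1) / 4) < u < 1 + (r - 1) / 4)%R).
  { apply (open_and (fun u : R => - ((r - 1) / 4) < u)%R (fun u : R => u < 1 + (r - 1) / 4)%R);
      [apply open_gt | apply open_lt | exact Hs]. }
  assert (HD : forall u t, (- ((r - 1) / 4) < u < 1 + (r - 1) / 4)%R ->
    is_derive (fun v => Re (kern v t)) u (Re (dkern u t))).
  { intros u t Hu. now apply rderiv_Re, kern_rderiv. }
  replace (RInt (fun t => Re (dkern s t)) 0 (2 * PI))
    with (RInt (fun t => Derive (fun u => Re (kern u t)) s) 0 (2 * PI)).
  2: { apply RInt_ext. intros t _. now apply is_derive_unique, HD. }
  apply is_derive_RInt_param.
  - apply (filter_imp _ _) with (2 := Hloc). intros u Hu t _.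
    exists (Re (dkern u t)). now apply HD.
  - intros t _. apply continuity_2d_pt_ext_loc with (fun u v => Re (dkern u v)).
    + destruct Hloc as [d Hl]. exists d. intros u v Hu _.
      symmetry. apply is_derive_unique, HD, Hl. exact Hu.
    + apply continuity_2d_pt_filterlim.
      exact (ccont_Re _ _ (dkern_ccont2 s t Hs)).
  - apply (filter_imp _ _) with (2 := Hloc). intros u Hu.
    now apply ex_RInt_Re, kern_rcont. }
(* The derivative is needed only on the open interval, so the division by [s] in [CInt_dkern] does
   no harm; at s = 0 continuity of [Phi] is enough. *)
destruct (MVT_gen Phi 0 1 (fun _ => 0%R)) as [c [_ Hc]].
- intros s Hs. rewrite Rmin_left, Rmax_right in Hs by lra.
  replace 0%R with (RInt (fun t => Re (dkern s t)) 0 (2 * PI)).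
  + apply Hd. lra.
  + exact (f_equal Re (CInt_dkern s ltac:(lra))).
- intros s Hs. rewrite Rmin_left, Rmax_right in Hs by lra.
  apply continuity_pt_filterlim, (ex_derive_continuous Phi s).
  eexists. apply Hd. lra.
- rewrite Rmult_0_l in Hc.
  transitivity (Phi 1%R); [| transitivity (Phi 0%R); [lra |]];
    apply RInt_ext; intros t _; unfold kern, path; do 3 f_equal; ring.
Qed.

End Cauchy.

Lemma Cauchy_formula (F F' : C -> C) (r : R) (x : C) :
  (1 < r)%R ->
  (forall y, (Cmod y < r)%R -> cderiv F y (F' y) /\ @ccont CU F' y) ->
  (Cmod x < 1)%R ->
  CInt (fun t => F (cis t) / (1 - x / cis t)) = RtoC (2 * PI) * F x.
Proof.
intros Hr HF Hx.
rewrite <- (CInt_Cauchy_kernel x Hx), Cmult_comm, <- CInt_scal.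
2: { intros t. apply ccont_div; [apply ccont_const | | now apply Cminus_div_cis_neq_0].
     apply ccont_minus; [apply ccont_const |].
     apply ccont_div; [apply ccont_const | apply rcont_cis | apply cis_neq_0]. }
rewrite (CInt_ext (fun t => F x * (1 / (1 - x / cis t))) (fun t => F x / (1 - x / cis t)))
  by (intros t; unfold Cdiv; ring).
(* The homotopy argument controls real parts; applied to [- Ci * F] it also gives the imaginary
   part. *)
assert (HiF : forall y, (Cmod y < r)%R ->
  cderiv (fun z => - Ci * F z) y (- Ci * F' y) /\ @ccont CU (fun z => - Ci * F' z) y).
{ intros y Hy. destruct (HF y Hy) as [H1 H2]. split.
  - now apply (gderiv_scal (U := CU)).
  - apply (ccont_mult (U := CU)); [apply ccont_const | exact H2]. }
assert (H1 := Cauchy_homotopy_Re F F' r x Hr HF Hx).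
assert (H2 := Cauchy_homotopy_Re _ _ r x Hr HiF Hx).
assert (Him : forall z w, Im (z / w) = Re (- Ci * z / w)).
{ intros z w. unfold Cdiv. generalize (/ w). intros k. destruct z, k. unfold Ci. simpl. ring. }
unfold CInt. f_equal; [exact H1 |].
rewrite (RInt_ext _ (fun t => Re (- Ci * F (cis t) / (1 - x / cis t)))) by (intros t _; apply Him).
rewrite H2. symmetry. apply RInt_ext. intros t _. apply Him.
Qed.

Definition analytic_at (f : C -> C) (z0 : C) : Prop :=
  exists (a : nat -> C) (r : R), (0 < r)%R /\
    forall z : C, (Cmod (z - z0) < r)%R ->
      @is_pseries C_AbsRing C_NormedModule a (z - z0) (f z).

(** The derivative is required to exist and be continuous on a neighbourhood, because the homotopy
    behind Cauchy's formula differentiates under the integral. This form is stable under the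
    algebraic operations and composition. *)
Definition C1_at (f : C -> C) (z0 : C) : Prop :=
  exists f' : C -> C,
    @locally CU z0 (fun z => cderiv f z (f' z) /\ @ccont CU f' z).

Lemma cderiv_shift (f : C -> C) (c z l : C) :
  cderiv f (z - c) l -> cderiv (fun x => f (x - c)) z l.
Proof.
intros H. rewrite <- (Cmult_1_r l).
apply (gderiv_comp (U := CU)); [apply ccont_id | exact H |].
replace (RtoC 1) with (1 + 0) by ring.
apply (gderiv_plus (U := CU)); [apply (gderiv_id (U := CU) (fun x => x)) | apply gderiv_const].
Qed.

Lemma pseries_ball_derive (a : nat -> C) (r : R) (f : C -> C) (z0 : C) :
  (forall z, (Cmod (z - z0) < r)%R -> cseries (fun n => a n * (z - z0) ^ n) (f z)) ->
  forall z, (Cmod (z - z0) < r)%R ->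
    cderiv f z (C_derive f z) /\
    cseries (fun n => RtoC (INR (S n)) * a (S n) * (z - z0) ^ n) (C_derive f z).
Proof.
intros Hf z Hz.
assert (Hf' : forall x, (Cmod x < r)%R -> cseries (fun n => a n * x ^ n) (f (x + z0))).
{ intros x Hx. assert (E : x + z0 - z0 = x) by ring.
  assert (H := Hf (x + z0)). rewrite E in H. now apply H. }
destruct (cderiv_pseries a r (fun x => f (x + z0)) (z - z0) Hf' Hz) as [l [Hl Hs]].
assert (Hd : cderiv f z l).
{ apply cderiv_shift in Hl. destruct Hl as [phi [H1 [H2 H3]]].
  exists phi. split; [exact H1 |]. split; [exact H2 |]. intros s.
  change C in s. generalize (H3 s). replace (s - z0 + z0) with s by ring.
  now replace (z - z0 + z0) with z by ring. }
rewrite (cderiv_unique_C_derive _ _ _ Hd). now split.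
Qed.

Lemma analytic_at_C_derive (f : C -> C) (z0 : C) :
  analytic_at f z0 -> analytic_at (C_derive f) z0.
Proof.
intros [a [r [Hr Hf]]].
exists (fun n => RtoC (INR (S n)) * a (S n)), r. split; [exact Hr |].
intros z Hz. apply is_psC. apply (pseries_ball_derive a r f z0); [| exact Hz].
intros y Hy. now apply is_psC, Hf.
Qed.

Lemma analytic_at_cderiv (f : C -> C) (z0 : C) :
  analytic_at f z0 -> @locally CU z0 (fun z => cderiv f z (C_derive f z)).
Proof.
intros [a [r [Hr Hf]]]. apply locally_CU. exists r. split; [exact Hr |].
intros z Hz. apply (pseries_ball_derive a r f z0); [| exact Hz].
intros y Hy. now apply is_psC, Hf.
Qed.

Lemma analytic_at_C1 (f : C -> C) (z0 : C) : analytic_at f z0 -> C1_at f z0.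
Proof.
intros H. exists (C_derive f).
generalize (analytic_at_cderiv _ _ H)
  (analytic_at_cderiv _ _ (analytic_at_C_derive _ _ H)). intros H1 H2.
apply (filter_imp _ _) with (2 := filter_and _ _ H1 H2).
intros z [K1 K2]. split; [exact K1 |]. now apply cderiv_cont with (1 := K2).
Qed.

Lemma C1_analytic_at (f : C -> C) (z0 : C) : C1_at f z0 -> analytic_at f z0.
Proof.
intros [f' H]. apply locally_CU in H. destruct H as [d [Hd H]].
(* Half the radius: after rescaling by [r], [F] is differentiable for |y| < 2, a disk that contains
   the closed unit disk as Cauchy's formula demands. *)
set (r := (d / 2)%R). assert (Hr : (0 < r)%R) by (unfold r; lra).
assert (Hr0 : RtoC r <> 0) by (intros E; apply RtoC_inj in E; lra).
set (F := fun x => f (z0 + RtoC r * x)).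
assert (HF : forall y, (Cmod y < 2)%R ->
  cderiv F y (f' (z0 + RtoC r * y) * RtoC r) /\
  @ccont CU (fun y => f' (z0 + RtoC r * y) * RtoC r) y).
{ intros y Hy. destruct (H (z0 + RtoC r * y)) as [H1 H2].
  { replace (z0 + RtoC r * y - z0) with (RtoC r * y) by ring.
    rewrite Cmod_mult, Cmod_R, Rabs_pos_eq by lra. unfold r in *. nra. }
  assert (Haff : cderiv (fun y => z0 + RtoC r * y) y (RtoC r)).
  { cut (cderiv (fun y => z0 + RtoC r * y) y (0 + RtoC r * 1));
      [now replace (0 + RtoC r * 1) with (RtoC r) by ring |].
    apply (gderiv_plus (U := CU)); [apply gderiv_const |].
    apply (gderiv_scal (U := CU)), (gderiv_id (U := CU) (fun x => x)). }
  split.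
  - exact (gderiv_comp (U := CU) _ ccont_id f (fun y => z0 + RtoC r * y) y _ _ H1 Haff).
  - apply (ccont_mult (U := CU)); [| apply ccont_const].
    apply (ccont_comp (U := CU) (fun y => z0 + RtoC r * y) f'); [| exact H2].
    now apply cderiv_cont with (RtoC r). }
assert (HFc : rcont (fun t => F (cis t))).
{ intros t. apply ccont_comp; [apply rcont_cis |].
  apply cderiv_cont with (1 := proj1 (HF _ ltac:(rewrite Cmod_cis; lra))). }
exists (fun n => / (RtoC (2 * PI) * RtoC r ^ n) * CInt (fun t => F (cis t) * (/ cis t) ^ n)), r.
split; [exact Hr |]. intros z Hz. apply is_psC.
set (x := (z - z0) / RtoC r).
assert (Hx : (Cmod x < 1)%R).
{ unfold x. rewrite Cmod_div, Cmod_R, Rabs_pos_eq by (trivial; lra).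
  apply Rmult_lt_reg_r with r; [exact Hr |]. field_simplify; lra. }
assert (Hpi : RtoC (2 * PI) <> 0).
{ intros E. apply RtoC_inj in E. generalize PI_RGT_0. lra. }
replace (f z) with (/ RtoC (2 * PI) * CInt (fun t => F (cis t) / (1 - x / cis t))).
- apply cseries_ext
    with (2 := cseries_scal (/ RtoC (2 * PI)) _ _ (Cauchy_kernel_series _ x HFc Hx)).
  intros n. replace (z - z0) with (RtoC r * x) by (unfold x; field; exact Hr0).
  rewrite Cpow_mult_l. field. split; [now apply Cpow_nz | exact Hpi].
- rewrite (Cauchy_formula F _ 2 x ltac:(lra) HF Hx), Cmult_assoc, Cinv_l, Cmult_1_l by exact Hpi.
  unfold F, x. f_equal. field. exact Hr0.
Qed.

(** * Analytic functions on the disk and the Schwarz lemma *)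

Lemma C1_at_ext_loc (f g : C -> C) (z : C) :
  @locally CU z (fun x => f x = g x) -> C1_at f z -> C1_at g z.
Proof.
intros He [f' H]. exists f'.
apply (filter_imp _ _) with (2 := filter_and _ _ (locally_locally _ _ He) H).
intros x [H1 [H2 H3]]. split; [now apply cderiv_ext_loc with (1 := H1) | exact H3].
Qed.

Lemma C1_at_const (c z : C) : C1_at (fun _ => c) z.
Proof.
exists (fun _ => 0). apply filter_forall. intros x.
split; [apply (gderiv_const (U := CU)) | apply (ccont_const (U := CU))].
Qed.

Lemma C1_at_id (z : C) : C1_at (fun x => x) z.
Proof.
exists (fun _ => 1). apply filter_forall. intros x.
split; [apply (gderiv_id (U := CU) (fun x => x)) | apply (ccont_const (U := CU))].
Qed.

Lemma C1_at_plus (f g : C -> C) (z : C) :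
  C1_at f z -> C1_at g z -> C1_at (fun x => f x + g x) z.
Proof.
intros [f' Hf] [g' Hg]. exists (fun x => f' x + g' x).
apply (filter_imp _ _) with (2 := filter_and _ _ Hf Hg).
intros x [[H1 H2] [K1 K2]]. split.
- now apply (gderiv_plus (U := CU)).
- now apply (ccont_plus (U := CU)).
Qed.

Lemma C1_at_mult (f g : C -> C) (z : C) :
  C1_at f z -> C1_at g z -> C1_at (fun x => f x * g x) z.
Proof.
intros [f' Hf] [g' Hg]. exists (fun x => f' x * g x + f x * g' x).
apply (filter_imp _ _) with (2 := filter_and _ _ Hf Hg).
intros x [[H1 H2] [K1 K2]]. split.
- apply (gderiv_mult (U := CU)); trivial. exact ccont_id.
- apply (ccont_plus (U := CU) (fun x => f' x * g x) (fun x => f x * g' x)).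
  + apply (ccont_mult (U := CU)); trivial. now apply cderiv_cont with (g' x).
  + apply (ccont_mult (U := CU)); trivial. now apply cderiv_cont with (f' x).
Qed.

Lemma C1_at_pow (f : C -> C) (n : nat) (z : C) :
  C1_at f z -> C1_at (fun x => f x ^ n) z.
Proof.
intros Hf. induction n as [|n IH]; [exact (C1_at_const 1 z) | now apply C1_at_mult].
Qed.

Lemma C1_at_comp (f g : C -> C) (z : C) :
  C1_at f (g z) -> C1_at g z -> C1_at (fun x => f (g x)) z.
Proof.
intros [f' Hf] [g' Hg]. exists (fun x => f' (g x) * g' x).
assert (Hc : @ccont CU g z).
{ apply cderiv_cont with (g' z). apply (locally_singleton _ _ Hg). }
specialize (Hc _ Hf). unfold filtermap in Hc.
apply (filter_imp _ _) with (2 := filter_and _ _ Hc Hg).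
intros x [[H1 H2] [K1 K2]]. split.
- apply (gderiv_comp (U := CU)); trivial. exact ccont_id.
- apply (ccont_mult (U := CU) (fun x => f' (g x))); trivial.
  apply (ccont_comp (U := CU) g f'); trivial. now apply cderiv_cont with (g' x).
Qed.

Lemma C1_at_Cinv (z : C) : z <> 0 -> C1_at Cinv z.
Proof.
intros Hz. exists (fun x => - / (x * x)).
apply (filter_imp _ _) with (2 := locally_neq_0 z Hz). intros x Hx.
split; [now apply cderiv_inv |].
apply (ccont_opp (U := CU) (fun x => / (x * x))), ccont_inv; [| now apply Cmult_neq_0].
apply (ccont_mult (U := CU)); apply ccont_id.
Qed.

Lemma C1_at_div (f g : C -> C) (z : C) :
  C1_at f z -> C1_at g z -> g z <> 0 -> C1_at (fun x => f x / g x) z.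
Proof.
intros Hf Hg H0. apply C1_at_mult; [exact Hf |].
apply (C1_at_comp Cinv g); [now apply C1_at_Cinv | exact Hg].
Qed.

Lemma analytic_on_disk_C1 (f : C -> C) :
  analytic_on_disk f <-> forall z, in_disk z -> C1_at f z.
Proof.
split; intros H z Hz; [apply analytic_at_C1 | apply C1_analytic_at]; exact (H z Hz).
Qed.

Lemma analytic_on_disk_derive (f : C -> C) (z : C) :
  analytic_on_disk f -> in_disk z ->
  cderiv f z (C_derive f z) /\ @ccont CU (C_derive f) z.
Proof.
intros Hf Hz. split.
- exact (locally_singleton _ _ (analytic_at_cderiv f z (Hf z Hz))).
- apply cderiv_cont with (C_derive (C_derive f) z).
  exact (locally_singleton _ _ (analytic_at_cderiv _ z (analytic_at_C_derive f z (Hf z Hz)))).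
Qed.

Lemma analytic_on_disk_C_derive (f : C -> C) :
  analytic_on_disk f -> analytic_on_disk (C_derive f).
Proof. intros Hf z Hz. exact (analytic_at_C_derive f z (Hf z Hz)). Qed.

Lemma cseries_at_0 (b : nat -> C) : cseries (fun n => b n * 0 ^ n) (b 0%nat).
Proof.
apply cseries_of_remainder with 0%R 0%R; [lra |]. intros n.
match goal with |- (Cmod ?c <= _)%R => replace c with (RtoC 0) end;
  [rewrite Cmod_0; lra |].
symmetry. apply -> Ceq_minus. induction n as [|n IH].
- rewrite sum_O. simpl. ring.
- rewrite sum_Sn, IH, Cpow_S, Cmult_0_l, Cmult_0_r. apply (Cplus_0_r (b 0%nat)).
Qed.

Definition div_var (f : C -> C) (z : C) : C :=
  if Ceq_dec z 0 then C_derive f 0 else f z / z.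

Lemma div_var_mult (f : C -> C) (z : C) : f 0 = 0 -> f z = z * div_var f z.
Proof.
intros H0. unfold div_var. destruct (Ceq_dec z 0) as [E | Hz].
- subst z. rewrite H0. ring.
- field. exact Hz.
Qed.

(** At 0 the coefficients are shifted by one, and the filled value is the first coefficient;
    elsewhere this is an ordinary quotient. *)
Lemma analytic_on_disk_div_var (f : C -> C) :
  analytic_on_disk f -> f 0 = 0 -> analytic_on_disk (div_var f).
Proof.
intros Hf H0 z0 Hz0. destruct (Ceq_dec z0 0) as [E | Hn].
- subst z0. destruct (Hf 0 Hz0) as [a [r [Hr Ha]]].
  assert (Hs : forall z, (Cmod (z - 0) < r)%R ->
    cseries (fun n => a n * (z - 0) ^ n) (f z)).
  { intros z Hz. now apply is_psC, Ha. }
  assert (H00 : (Cmod (0 - 0) < r)%R).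
  { replace (0 - 0) with (RtoC 0) by ring. now rewrite Cmod_0. }
  assert (Ha0 : a 0%nat = 0).
  { rewrite <- H0. apply cseries_unique with (1 := cseries_at_0 a).
    generalize (Hs 0 H00). now replace (0 - 0) with (RtoC 0) by ring. }
  assert (Ha1 : C_derive f 0 = a 1%nat).
  { destruct (pseries_ball_derive a r f 0 Hs 0 H00) as [_ H].
    replace (0 - 0) with (RtoC 0) in H by ring.
    rewrite (cseries_unique _ _ _ H (cseries_at_0 (fun n => RtoC (INR (S n)) * a (S n)))).
    simpl. ring. }
  exists (fun n => a (S n)), r. split; [exact Hr |]. intros z Hz. apply is_psC.
  unfold div_var. destruct (Ceq_dec z 0) as [E | Hz0'].
  + subst z. rewrite Ha1. replace (0 - 0) with (RtoC 0) by ring.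
    apply (cseries_at_0 (fun n => a (S n))).
  + assert (H := cseries_scal (/ z) _ _ (cseries_shift _ _ (Hs z Hz))).
    replace (f z / z) with (/ z * (f z - a 0%nat * (z - 0) ^ 0))
      by (rewrite Ha0; field; exact Hz0').
    apply cseries_ext with (2 := H). intros n.
    rewrite Cpow_S. replace (z - 0) with z by ring. field. exact Hz0'.
- apply C1_analytic_at. apply C1_at_ext_loc with (fun z => f z / z).
  + apply (filter_imp _ _) with (2 := locally_neq_0 z0 Hn). intros x Hx.
    unfold div_var. now destruct (Ceq_dec x 0).
  + apply C1_at_div; [now apply analytic_at_C1, Hf | apply C1_at_id | exact Hn].
Qed.

Lemma le_1_of_bounded_pow (q B : R) :
  (forall n : nat, (q ^ n <= B)%R) -> (q <= 1)%R.
Proof.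
intros H. apply Rnot_lt_le. intros Hq.
destruct (Pow_x_infinity q ltac:(rewrite Rabs_pos_eq; lra) (B + 1)) as [N HN].
specialize (HN N (le_n N)). specialize (H N).
rewrite Rabs_pos_eq in HN by (apply pow_le; lra). lra.
Qed.

(* Landau's trick: the constant lost in bounding the Cauchy integral disappears
   on applying the bound to all powers of [v]. *)
Lemma disk_bound_of_circle_bound (v : C -> C) (rho M : R) (z : C) :
  analytic_on_disk v -> (Cmod z < rho < 1)%R ->
  (forall y, Cmod y = rho -> (Cmod (v y) <= M)%R) -> (0 < M)%R ->
  (Cmod (v z) <= M)%R.
Proof.
intros Hv [Hz Hrho] HM HM0.
assert (Hz0 := Cmod_ge_0 z).
assert (Hr0 : RtoC rho <> 0) by (intros E; apply RtoC_inj in E; lra).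
set (x := z / RtoC rho).
assert (Hx : (Cmod x < 1)%R).
{ unfold x. rewrite Cmod_div, Cmod_R, Rabs_pos_eq by (trivial; lra).
  apply Rmult_lt_reg_r with rho; [lra |]. field_simplify; lra. }
(* The 2 is the quotient of the 4 PI in the integral bound by the 2 PI in Cauchy's formula. It does
   not depend on [n], so bounded powers force the base to be at most 1. *)
assert (HB : forall n, ((Cmod (v z) / M) ^ n <= 2 / (1 - Cmod x))%R).
{ intros n.
  set (F := fun y => v (RtoC rho * y) ^ n).
  assert (HF : exists F', forall y, (Cmod y < / rho)%R -> cderiv F y (F' y) /\ @ccont CU F' y).
  { exists (fun y => C_derive (fun y => v y ^ n) (RtoC rho * y) * RtoC rho). intros y Hy.
    assert (Hd : in_disk (RtoC rho * y)).
    { unfold in_disk. rewrite Cmod_mult, Cmod_R, Rabs_pos_eq by lra.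
      apply Rmult_lt_reg_l with (/ rho)%R; [apply Rinv_0_lt_compat; lra |].
      rewrite <- Rmult_assoc, Rinv_l, Rmult_1_l, Rmult_1_r by lra. exact Hy. }
    assert (Hvn : analytic_on_disk (fun y => v y ^ n)).
    { apply analytic_on_disk_C1. intros w Hw. apply C1_at_pow.
      now apply analytic_at_C1, Hv. }
    destruct (analytic_on_disk_derive _ _ Hvn Hd) as [H1 H2].
    assert (Hl : cderiv (fun y => RtoC rho * y) y (RtoC rho)).
    { cut (cderiv (fun y => RtoC rho * y) y (RtoC rho * 1)); [now rewrite Cmult_1_r |].
      apply (gderiv_scal (U := CU)), (gderiv_id (U := CU) (fun x => x)). }
    split.
    - exact (gderiv_comp (U := CU) _ ccont_id (fun y => v y ^ n)
               (fun y => RtoC rho * y) y _ _ H1 Hl).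
    - apply (ccont_mult (U := CU)); [| apply ccont_const].
      apply (ccont_comp (U := CU) (fun y => RtoC rho * y)); [| exact H2].
      now apply cderiv_cont with (1 := Hl). }
  destruct HF as [F' HF].
  assert (Hr1 : (1 < / rho)%R) by (rewrite <- Rinv_1; apply Rinv_lt_contravar; lra).
  assert (HC := Cauchy_formula F F' (/ rho) x Hr1 HF Hx).
  assert (Hb : (Cmod (CInt (fun t => F (cis t) / (1 - x / cis t))%C)
                <= 4 * PI * (M ^ n / (1 - Cmod x)))%R).
  { apply Cmod_CInt_le.
    - intros t. apply (ccont_div (U := R_UniformSpace) (fun t => F (cis t)));
        [| | now apply Cminus_div_cis_neq_0].
      + apply (ccont_comp (U := R_UniformSpace) cis F); [apply rcont_cis |].
        apply cderiv_cont with (1 := proj1 (HF _ ltac:(rewrite Cmod_cis; lra))).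
      + apply ccont_minus; [apply ccont_const |].
        apply ccont_div; [apply ccont_const | apply rcont_cis | apply cis_neq_0].
    - intros t _. destruct (Cminus_div_cis_neq_0 x t Hx) as [H1 H2].
      rewrite Cmod_div by exact H2. unfold F. rewrite Cmod_pow. unfold Rdiv.
      apply Rmult_le_compat; [apply pow_le, Cmod_ge_0 | | |].
      + apply Rlt_le, Rinv_0_lt_compat. lra.
      + apply pow_incr. split; [apply Cmod_ge_0 |]. apply HM.
        rewrite Cmod_mult, Cmod_cis, Cmod_R, Rabs_pos_eq; lra.
      + apply Rinv_le_contravar; lra. }
  assert (Hpi := PI_RGT_0).
  rewrite HC, Cmod_mult, Cmod_R, Rabs_pos_eq in Hb by lra. unfold F in Hb.
  rewrite Cmod_pow in Hb.
  replace (RtoC rho * x) with z in Hb by (unfold x; field; exact Hr0).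
  assert (HMn : (0 < M ^ n)%R) by (now apply pow_lt).
  unfold Rdiv. rewrite Rpow_mult_distr, pow_inv.
  change (Cmod (v z) ^ n / M ^ n <= 2 / (1 - Cmod x))%R.
  apply Rmult_le_reg_l with (2 * PI * M ^ n)%R.
  { apply Rmult_lt_0_compat; lra. }
  replace (2 * PI * M ^ n * (Cmod (v z) ^ n / M ^ n))%R with (2 * PI * Cmod (v z) ^ n)%R
    by (field; lra).
  replace (2 * PI * M ^ n * (2 / (1 - Cmod x)))%R with (4 * PI * (M ^ n / (1 - Cmod x)))%R
    by (field; lra).
  exact Hb. }
apply le_1_of_bounded_pow in HB.
apply Rmult_le_reg_r with (/ M)%R; [now apply Rinv_0_lt_compat |].
rewrite Rinv_r by lra. exact HB.
Qed.

(** On the circle of radius rho the quotient w(y)/y is at most 1/rho in modulus, hence also inside;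
    then rho tends to 1. *)
Lemma Schwarz_lemma (w : C -> C) (z : C) :
  analytic_on_disk w -> w 0 = 0 ->
  (forall y, in_disk y -> (Cmod (w y) < 1)%R) -> in_disk z ->
  (Cmod (w z) <= Cmod z)%R.
Proof.
intros Hw H0 Hb Hz. unfold in_disk in Hz.
rewrite (div_var_mult w z H0), Cmod_mult.
rewrite <- (Rmult_1_r (Cmod z)) at 2. apply Rmult_le_compat_l; [apply Cmod_ge_0 |].
assert (Hv := analytic_on_disk_div_var w Hw H0).
assert (Hz0 := Cmod_ge_0 z).
assert (Hrho : forall rho, (Cmod z < rho < 1)%R -> (Cmod (div_var w z) <= / rho)%R).
{ intros rho Hr. apply disk_bound_of_circle_bound with rho; trivial.
  - intros y Hy. assert (Hy0 : y <> 0) by (apply Cmod_gt_0; lra).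
    unfold div_var. destruct (Ceq_dec y 0) as [E | _]; [easy |].
    rewrite Cmod_div, Hy by exact Hy0. unfold Rdiv.
    rewrite <- (Rmult_1_l (/ rho)) at 2.
    apply Rmult_le_compat_r; [apply Rlt_le, Rinv_0_lt_compat; lra |].
    apply Rlt_le, Hb. unfold in_disk. lra.
  - apply Rinv_0_lt_compat. lra. }
apply Rnot_lt_le. intros Hgt.
set (m := Cmod (div_var w z)) in *.
assert (Hm : (/ m < 1)%R) by (rewrite <- Rinv_1; apply Rinv_lt_contravar; lra).
(* If the quotient had modulus m > 1 at [z], this radius, above both |z| and 1/m and still below 1,
   would contradict the bound 1/rho. *)
set (rho := Rmax ((1 + Cmod z) / 2) ((1 + / m) / 2)).
assert (H1 : (Cmod z < rho)%R) by (apply Rlt_le_trans with (2 := Rmax_l _ _); lra).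
assert (H2 : (/ m < rho)%R) by (apply Rlt_le_trans with (2 := Rmax_r _ _); lra).
assert (H3 : (rho < 1)%R) by (apply Rmax_lub_lt; lra).
assert (Him : (0 < / m)%R) by (apply Rinv_0_lt_compat; lra).
specialize (Hrho rho (conj H1 H3)).
apply Rinv_lt_contravar in H2; [| nra]. rewrite Rinv_inv in H2. lra.
Qed.

(** * The inverse of [phi_Ne] *)

Fixpoint Ne_iter (c : C) (n : nat) : C :=
  match n with
  | O => 0
  | S m => c + Ne_iter c m ^ 3 / 3
  end.

(** The limit of the iterates is written as a telescoping series, so that geometric domination of
    the steps gives its existence; the start at 0 makes the partial sums equal to the iterates. *)
Definition Ne_inv (c : C) : C := CSeries (fun n => Ne_iter c (S n) - Ne_iter c n).

Lemma C3_neq_0 : RtoC 3 <> 0.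
Proof. intros E. apply RtoC_inj in E. lra. Qed.

Lemma Cmod_C3 : Cmod 3 = 3%R.
Proof. rewrite Cmod_R, Rabs_pos_eq; lra. Qed.

(** The expression is the divided difference of u^3/3, so the bound is a contraction factor: at most
    1 on the closed unit disk, and less than 1 once one of the two radii is. *)
Lemma Cmod_cubic_quotient_le (u v : C) (a b : R) :
  (Cmod u <= a)%R -> (Cmod v <= b)%R ->
  (Cmod ((u ^ 2 + u * v + v ^ 2) / 3) <= (a ^ 2 + a * b + b ^ 2) / 3)%R.
Proof.
intros Hu Hv. rewrite Cmod_div, Cmod_C3 by exact C3_neq_0.
apply Rmult_le_compat_r; [lra |].
assert (Hu0 := Cmod_ge_0 u). assert (Hv0 := Cmod_ge_0 v).
eapply Rle_trans; [apply Cmod_triangle |]. apply Rplus_le_compat.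
- eapply Rle_trans; [apply Cmod_triangle |]. rewrite Cmod_pow, Cmod_mult.
  apply Rplus_le_compat; [apply pow_incr; lra | apply Rmult_le_compat; trivial].
- rewrite Cmod_pow. apply pow_incr. lra.
Qed.

(** The disk of radius 1/3 + |c| is invariant because that radius is at most 1, so a third of its
    cube is at most 1/3. This is where 2/3 is used. *)
Lemma Ne_iter_bound (c : C) (n : nat) :
  (Cmod c < 2 / 3)%R -> (Cmod (Ne_iter c n) <= 1 / 3 + Cmod c)%R.
Proof.
intros Hc. assert (Hc0 := Cmod_ge_0 c). induction n as [|n IH].
- simpl Ne_iter. rewrite Cmod_0. lra.
- simpl Ne_iter. eapply Rle_trans; [apply Cmod_triangle |].
  change (Ne_iter c n * (Ne_iter c n * (Ne_iter c n * 1))) with (Ne_iter c n ^ 3).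
  rewrite Cmod_div, Cmod_C3, Cmod_pow by exact C3_neq_0.
  assert (H3 : (Cmod (Ne_iter c n) ^ 3 <= (1 / 3 + Cmod c) ^ 3)%R).
  { apply pow_incr. split; [apply Cmod_ge_0 | exact IH]. }
  assert (Hr : ((1 / 3 + Cmod c) ^ 3 <= 1)%R).
  { rewrite <- (pow1 3). apply pow_incr. lra. }
  lra.
Qed.

Lemma Ne_iter_step (c : C) (n : nat) :
  (Cmod c < 2 / 3)%R ->
  (Cmod (Ne_iter c (S n) - Ne_iter c n) <= ((1 / 3 + Cmod c) ^ 2) ^ n)%R.
Proof.
intros Hc. set (rho := (1 / 3 + Cmod c)%R). induction n as [|n IH].
- simpl Ne_iter. replace (c + 0 * (0 * (0 * 1)) / 3 - 0) with c
    by field. simpl. lra.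
- set (u := Ne_iter c (S n)) in *. set (v := Ne_iter c n) in *.
  replace (Ne_iter c (S (S n)) - u) with ((u - v) * ((u ^ 2 + u * v + v ^ 2) / 3)).
  + rewrite Cmod_mult, <- tech_pow_Rmult, Rmult_comm.
    apply Rmult_le_compat; try apply Cmod_ge_0; [| exact IH].
    replace (rho ^ 2)%R with ((rho ^ 2 + rho * rho + rho ^ 2) / 3)%R by field.
    apply Cmod_cubic_quotient_le; now apply Ne_iter_bound.
  + change (Ne_iter c (S (S n))) with (c + u ^ 3 / 3).
    assert (Hu : c = u - v ^ 3 / 3).
    { change u with (c + v ^ 3 / 3). ring. }
    clearbody u v. rewrite Hu. field.
Qed.

Lemma Cmod_le_eps (z : C) :
  (forall eps, (0 < eps)%R -> (Cmod z <= eps)%R) -> z = 0.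
Proof.
intros H. apply Cmod_eq_0. apply Rle_antisym; [| apply Cmod_ge_0].
apply le_epsilon. intros eps He. rewrite Rplus_0_l. now apply H.
Qed.

Lemma Ne_iter_lim (c : C) :
  (Cmod c < 2 / 3)%R -> forall eps, (0 < eps)%R ->
  exists N, forall n, (N <= n)%nat -> (Cmod (Ne_inv c - Ne_iter c n) <= eps)%R.
Proof.
intros Hc eps He. assert (Hc0 := Cmod_ge_0 c).
assert (Hs : cseries (fun n => Ne_iter c (S n) - Ne_iter c n) (Ne_inv c)).
{ apply cseries_abs.
  apply (@ex_series_le R_AbsRing R_CompleteNormedModule)
    with (fun n => ((1 / 3 + Cmod c) ^ 2) ^ n)%R.
  - intros n. unfold norm; simpl norm. unfold abs; simpl abs.
    rewrite Rabs_pos_eq by apply Cmod_ge_0. now apply Ne_iter_step.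
  - apply ex_series_geom. rewrite Rabs_pos_eq by (apply pow_le; lra). nra. }
assert (Hsum : forall n,
  @sum_n C_NormedModule (fun n => Ne_iter c (S n) - Ne_iter c n) n = Ne_iter c (S n)).
{ induction n as [|n IH].
  - rewrite sum_O. change (Ne_iter c 1 - 0 = Ne_iter c 1). ring.
  - rewrite sum_Sn, IH.
    change (Ne_iter c (S n) + (Ne_iter c (S (S n)) - Ne_iter c (S n)) = Ne_iter c (S (S n))).
    ring. }
assert (He2 : (0 < eps / 2)%R) by lra.
apply cseriesP in Hs. destruct Hs as [H1 H2].
destruct (proj1 (filterlim_locally _ _) H1 (mkposreal _ He2)) as [N1 HN1].
destruct (proj1 (filterlim_locally _ _) H2 (mkposreal _ He2)) as [N2 HN2].
exists (S (max N1 N2)). intros [| n] Hn; [lia |].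
specialize (HN1 n ltac:(lia)). specialize (HN2 n ltac:(lia)).
rewrite <- Re_sum_n, Hsum in HN1. rewrite <- Im_sum_n, Hsum in HN2.
replace (Ne_inv c - Ne_iter c (S n)) with (- (Ne_iter c (S n) - Ne_inv c)) by ring.
rewrite Cmod_opp. eapply Rle_trans; [apply Cmod_le_Rabs |].
change (Rabs (Re (Ne_iter c (S n) - Ne_inv c)) < eps / 2)%R in HN1.
change (Rabs (Im (Ne_iter c (S n) - Ne_inv c)) < eps / 2)%R in HN2.
lra.
Qed.

Lemma Cmod_Ne_inv (c : C) :
  (Cmod c < 2 / 3)%R -> (Cmod (Ne_inv c) <= 1 / 3 + Cmod c)%R.
Proof.
intros Hc. apply le_epsilon. intros eps He.
destruct (Ne_iter_lim c Hc eps He) as [N HN]. specialize (HN N (le_n N)).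
generalize (Ne_iter_bound c N Hc) (Cmod_minus_le (Ne_inv c) (Ne_iter c N)). lra.
Qed.

Lemma Ne_inv_lt_1 (c : C) : (Cmod c < 2 / 3)%R -> (Cmod (Ne_inv c) < 1)%R.
Proof. intros Hc. generalize (Cmod_Ne_inv c Hc). lra. Qed.

Lemma Ne_inv_spec (c : C) :
  (Cmod c < 2 / 3)%R -> Ne_inv c - Ne_inv c ^ 3 / 3 = c.
Proof.
intros Hc. apply Ceq_minus, Cmod_le_eps. intros eps He.
destruct (Ne_iter_lim c Hc (eps / 2) ltac:(lra)) as [N HN].
assert (H1 := HN N (le_n N)). assert (H2 := HN (S N) (le_S _ _ (le_n N))).
set (L := Ne_inv c) in *. set (u := Ne_iter c N) in *.
change (Ne_iter c (S N)) with (c + u ^ 3 / 3) in H2.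
(* Two consecutive iterates split the defect into two parts of size at most eps/2, the second
   carrying a divided difference of modulus at most 1. *)
replace (L - L ^ 3 / 3 - c) with
  (L - (c + u ^ 3 / 3) + - ((L - u) * ((L ^ 2 + L * u + u ^ 2) / 3)))
  by field.
eapply Rle_trans; [apply Cmod_triangle |]. rewrite Cmod_opp, Cmod_mult.
assert (Hq : (Cmod ((L ^ 2 + L * u + u ^ 2) / 3) <= 1)%R).
{ replace 1%R with ((1 ^ 2 + 1 * 1 + 1 ^ 2) / 3)%R by field.
  apply Cmod_cubic_quotient_le.
  - apply Rlt_le. now apply Ne_inv_lt_1.
  - generalize (Ne_iter_bound c N Hc). fold u. lra. }
assert (H0 := Cmod_ge_0 (L - u)). nra.
Qed.

Lemma phi_Ne_inv (c : C) : (Cmod c < 2 / 3)%R -> phi_Ne (Ne_inv c) = 1 + c.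
Proof.
intros Hc. unfold phi_Ne. rewrite <- (Ne_inv_spec c Hc) at 3.
unfold Cminus. ring.
Qed.

(** The other roots of u - u^3/3 have modulus sqrt 3, whereas the bound at c = 0 leaves only modulus
    at most 1/3. *)
Lemma Ne_inv_0 : Ne_inv 0 = 0.
Proof.
assert (H := Cmod_Ne_inv 0). assert (E := Ne_inv_spec 0).
rewrite Cmod_0 in H, E. specialize (H ltac:(lra)). specialize (E ltac:(lra)).
set (u := Ne_inv 0) in *.
destruct (Ceq_dec u 0) as [Hu | Hu]; [exact Hu | exfalso].
assert (Hu2 : u ^ 2 = 3).
{ replace (u ^ 2) with (3 - (u - u ^ 3 / 3) * (3 / u)) by (field; exact Hu).
  rewrite E. ring. }
apply (f_equal Cmod) in Hu2. rewrite Cmod_pow, Cmod_C3 in Hu2.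
assert (H0 := Cmod_ge_0 u). nra.
Qed.

(** The difference of the two cubic equations factors as (v - u)(1 - q), and |q| stays below 1 with
    a margin depending on [c] only. The same formula thus yields Lipschitz continuity at [c] and the
    slope of the inverse. *)
Lemma Ne_inv_diff (c d : C) :
  (Cmod c < 2 / 3)%R -> (Cmod d < 2 / 3)%R ->
  let q := (Ne_inv d ^ 2 + Ne_inv d * Ne_inv c + Ne_inv c ^ 2) / 3 in
  (0 < (2 - Cmod (Ne_inv c) - Cmod (Ne_inv c) ^ 2) / 3 <= Cmod (1 - q))%R /\
  Ne_inv d - Ne_inv c = (d - c) * (/ (1 - q)).
Proof.
intros Hc Hd q.
assert (Hu := Ne_inv_lt_1 c Hc). assert (Hv := Ne_inv_lt_1 d Hd).
assert (Hq : (Cmod q <= (1 ^ 2 + 1 * Cmod (Ne_inv c) + Cmod (Ne_inv c) ^ 2) / 3)%R).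
{ apply Cmod_cubic_quotient_le; lra. }
assert (H0 := Cmod_ge_0 (Ne_inv c)).
assert (Hk : (0 < (2 - Cmod (Ne_inv c) - Cmod (Ne_inv c) ^ 2) / 3 <= Cmod (1 - q))%R).
{ split; [nra |]. generalize (Cmod_minus_le 1 q). rewrite Cmod_1. lra. }
split; [exact Hk |].
assert (Hn : 1 - q <> 0) by (apply Cmod_gt_0; lra).
rewrite <- (Ne_inv_spec c Hc) at 2. rewrite <- (Ne_inv_spec d Hd) at 2.
replace (Ne_inv d - Ne_inv d ^ 3 / 3 - (Ne_inv c - Ne_inv c ^ 3 / 3))
  with ((Ne_inv d - Ne_inv c) * (1 - q)) by (unfold q; field).
rewrite <- Cmult_assoc, Cinv_r by exact Hn. ring.
Qed.

Lemma locally_Cmod_lt (c : C) (r : R) :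
  (Cmod c < r)%R -> @locally CU c (fun x : C => (Cmod x < r)%R).
Proof.
intros Hc. apply locally_CU. exists (r - Cmod c)%R. split; [lra |].
intros x Hx. generalize (Cmod_minus_le x c). lra.
Qed.

Lemma Ne_inv_ccont (c : C) : (Cmod c < 2 / 3)%R -> @ccont CU Ne_inv c.
Proof.
intros Hc. apply ccontP. intros eps.
set (k := ((2 - Cmod (Ne_inv c) - Cmod (Ne_inv c) ^ 2) / 3)%R).
assert (Hk : (0 < k)%R) by apply (Ne_inv_diff c c Hc Hc).
assert (He : (0 < eps * k)%R) by (apply Rmult_lt_0_compat; [apply cond_pos | exact Hk]).
assert (Hball : @locally CU c (fun x : C => (Cmod (x - c) < eps * k)%R)).
{ apply locally_CU. now exists (eps * k)%R. }
apply (filter_imp _ _) with (2 := filter_and _ _ Hball (locally_Cmod_lt c _ Hc)).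
intros x [Hx Hx2]. destruct (Ne_inv_diff c x Hc Hx2) as [H1 H2]. fold k in H1.
rewrite H2, Cmod_mult, Cmod_inv by (apply Cmod_gt_0; lra).
apply Rmult_lt_reg_r with k; [exact Hk |].
apply Rle_lt_trans with (2 := Hx). rewrite Rmult_assoc.
rewrite <- (Rmult_1_r (Cmod (x - c))) at 2.
apply Rmult_le_compat_l; [apply Cmod_ge_0 |].
match goal with |- (/ ?m * k <= 1)%R => apply Rmult_le_reg_l with m; [lra |];
  rewrite <- Rmult_assoc, Rinv_r by lra end. lra.
Qed.

Lemma C1_at_Ne_inv (c : C) : (Cmod c < 2 / 3)%R -> C1_at Ne_inv c.
Proof.
intros Hc.
(* With u = [Ne_inv d] this is 1/(1 - u^2), written as the diagonal case of the slope in
   [Ne_inv_diff]. *)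
exists (fun d => / (1 - (Ne_inv d ^ 2 + Ne_inv d * Ne_inv d + Ne_inv d ^ 2) / 3)).
apply (filter_imp _ _) with (2 := locally_Cmod_lt c _ Hc). clear c Hc. intros c Hc.
assert (Hcont := Ne_inv_ccont c Hc).
assert (Hn : 1 - (Ne_inv c ^ 2 + Ne_inv c * Ne_inv c + Ne_inv c ^ 2) / 3 <> 0).
{ apply Cmod_gt_0. destruct (Ne_inv_diff c c Hc Hc) as [H _]. lra. }
(* One continuity statement covers both uses: a constant [g] gives the slope at [c], and
   [g = Ne_inv] gives the derivative. *)
assert (Hq : forall g : CU -> C, @ccont CU g c -> g c = Ne_inv c ->
  @ccont CU (fun d => / (1 - (Ne_inv d ^ 2 + Ne_inv d * g d + g d ^ 2) / 3)) c).
{ intros g Hg Eg. apply (ccont_inv (U := CU)); [| now rewrite Eg].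
  apply (ccont_minus (U := CU)); [apply ccont_const |].
  apply (ccont_div (U := CU)); [| apply ccont_const | exact C3_neq_0].
  apply (ccont_plus (U := CU)); [apply (ccont_plus (U := CU)) |].
  - now apply (ccont_pow (U := CU)).
  - now apply (ccont_mult (U := CU)).
  - now apply (ccont_pow (U := CU)). }
split; [| now apply Hq].
apply cderiv_local
  with (fun d => / (1 - (Ne_inv d ^ 2 + Ne_inv d * Ne_inv c + Ne_inv c ^ 2) / 3)).
- apply (Hq (fun _ => Ne_inv c)); [apply ccont_const | reflexivity].
- reflexivity.
- apply (filter_imp _ _) with (2 := locally_Cmod_lt c _ Hc). intros d Hd.
  now apply Ne_inv_diff.
Qed.

Lemma analytic_phi_Ne : analytic_on_disk phi_Ne.
Proof.
apply analytic_on_disk_C1. intros z _. unfold phi_Ne.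
apply C1_at_ext_loc with (fun z => 1 + z + -1 / 3 * z ^ 3).
- apply filter_forall. intros x. field.
- apply (C1_at_plus (fun z => 1 + z)).
  + apply (C1_at_plus (fun _ => 1) (fun z => z)); [apply C1_at_const | apply C1_at_id].
  + apply (C1_at_mult (fun _ => -1 / 3) (fun z => z ^ 3)); [apply C1_at_const |].
    apply (C1_at_pow (fun z => z)), C1_at_id.
Qed.

(** * The extremal function on the real axis, the Gamma function and [beta_L] *)

Local Open Scope R_scope.

(* [sqrt_coef j] is the Pochhammer quotient (-1/2)_j / j!. *)
Fixpoint sqrt_coef (j : nat) : R :=
  match j with
  | O => 1
  | S i => sqrt_coef i * (INR i - 1 / 2) / INR (S i)
  end.

Lemma sqrt_coef_S (j : nat) : INR (S j) * sqrt_coef (S j) = sqrt_coef j * (INR j - 1 / 2).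
Proof.
change (sqrt_coef (S j)) with (sqrt_coef j * (INR j - 1 / 2) / INR (S j)).
field. now apply not_0_INR. Qed.

Lemma sqrt_coef_1 : sqrt_coef 1 = - (1 / 2).
Proof. simpl. field. Qed.

Lemma sqrt_coef_S_neg (j : nat) : sqrt_coef (S j) < 0.
Proof.
induction j as [|j IH]; [rewrite sqrt_coef_1; lra |].
assert (H := sqrt_coef_S (S j)). assert (H1 := pos_INR j).
rewrite !S_INR in H. nra.
Qed.

(** The partial sums at x = 1 have a closed form, nonnegative by the signs of the coefficients. As
    the terms after the first are negative, this gives absolute convergence on the boundary by
    monotonicity alone. *)
Lemma sum_sqrt_coef (n : nat) : sum_n sqrt_coef n = sqrt_coef n * (1 - 2 * INR n).
Proof.
induction n as [|n IH]; [rewrite sum_O; simpl; ring |].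
rewrite sum_Sn, IH. change plus with Rplus.
assert (H := sqrt_coef_S n). rewrite S_INR in *. lra.
Qed.

Lemma sum_sqrt_coef_ge_0 (n : nat) : 0 <= sum_n sqrt_coef n.
Proof.
rewrite sum_sqrt_coef. destruct n as [|n]; [simpl; lra |].
assert (H := sqrt_coef_S_neg n). assert (H1 := pos_INR n). rewrite S_INR. nra.
Qed.

Lemma sum_sqrt_coef_shift (n : nat) :
  sum_n (fun j => - sqrt_coef (S j)) n = 1 - sum_n sqrt_coef (S n).
Proof.
induction n as [|n IH].
- rewrite sum_Sn, !sum_O. change (- sqrt_coef 1 = 1 - (1 + sqrt_coef 1)). ring.
- rewrite sum_Sn, IH, (sum_Sn sqrt_coef (S n)).
  change (1 - sum_n sqrt_coef (S n) + - sqrt_coef (S (S n)) =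
    1 - (sum_n sqrt_coef (S n) + sqrt_coef (S (S n)))).
  ring.
Qed.

Lemma ex_lim_sum_sqrt_coef_shift :
  ex_finite_lim_seq (sum_n (fun j => - sqrt_coef (S j))).
Proof.
apply ex_finite_lim_seq_incr with 1; intros n.
- rewrite sum_Sn. change plus with Rplus. generalize (sqrt_coef_S_neg (S n)). lra.
- rewrite sum_sqrt_coef_shift. generalize (sum_sqrt_coef_ge_0 (S n)). lra.
Qed.

Lemma ex_series_sqrt_coef_shift : ex_series (fun j => - sqrt_coef (S j)).
Proof. destruct ex_lim_sum_sqrt_coef_shift as [l Hl]. now exists l. Qed.

Lemma Series_sqrt_coef_shift_le : Series (fun j => - sqrt_coef (S j)) <= 1.
Proof.
apply (is_lim_seq_le (sum_n (fun j => - sqrt_coef (S j))) (fun _ => 1)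
  (Series (fun j => - sqrt_coef (S j))) 1).
- intros n. rewrite sum_sqrt_coef_shift. generalize (sum_sqrt_coef_ge_0 (S n)). lra.
- exact (Series_correct _ ex_series_sqrt_coef_shift).
- apply is_lim_seq_const.
Qed.

Lemma ex_series_abs_sqrt_coef : ex_series (fun j => Rabs (sqrt_coef j)).
Proof.
apply ex_series_incr_1. apply ex_series_ext with (2 := ex_series_sqrt_coef_shift).
intros j. rewrite Rabs_left; [reflexivity | apply sqrt_coef_S_neg].
Qed.

Lemma Rabs_sqrt_coef_le_1 (j : nat) : Rabs (sqrt_coef j) <= 1.
Proof.
destruct j as [|j]; [simpl; rewrite Rabs_R1; lra |].
rewrite Rabs_left by apply sqrt_coef_S_neg.
assert (H1 : - sqrt_coef (S j) <= sum_n (fun j => - sqrt_coef (S j)) j).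
{ destruct j as [|j]; [rewrite sum_O; lra |].
  rewrite sum_Sn, sum_sqrt_coef_shift. change plus with Rplus.
  assert (H : sum_n sqrt_coef (S j) <= 1).
  { clear. induction j as [|j IH].
    - rewrite sum_Sn, sum_O. change plus with Rplus. rewrite sqrt_coef_1. simpl. lra.
    - rewrite sum_Sn. change plus with Rplus. generalize (sqrt_coef_S_neg (S j)). lra. }
  lra. }
rewrite sum_sqrt_coef_shift in H1. generalize (sum_sqrt_coef_ge_0 (S j)). lra.
Qed.

Lemma Series_ge_0 (u : nat -> R) : (forall n, 0 <= u n) -> ex_series u -> 0 <= Series u.
Proof.
intros H Hu. rewrite <- (Rmult_0_l (Series u)), <- Series_scal_l.
apply Series_le; [| exact Hu]. intros n. generalize (H n). lra.
Qed.

Lemma Series_monotone (u v : nat -> R) :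
  (forall n, u n <= v n) -> ex_series u -> ex_series v -> Series u <= Series v.
Proof.
intros H Hu Hv. assert (H0 := Series_minus v u Hv Hu).
assert (H1 : 0 <= Series (fun n => v n - u n)).
{ apply Series_ge_0; [intros n; generalize (H n); lra |].
  exact (ex_series_minus v u Hv Hu). }
lra.
Qed.

(** Strictness is asked at index 1 because the terms of index 0 agree in every application. *)
Lemma Series_lt_at_1 (u v : nat -> R) :
  (forall n, u n <= v n) -> u 1%nat < v 1%nat -> ex_series u -> ex_series v ->
  Series u < Series v.
Proof.
intros H H1 Hu Hv.
rewrite (Series_incr_n u 2), (Series_incr_n v 2) by (trivial; lia).
assert (HT : Series (fun k => u (2 + k)%nat) <= Series (fun k => v (2 + k)%nat)).
{ apply Series_monotone; [intros n; apply H | |]; now apply ex_series_incr_n. }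
simpl sum_f_R0. generalize (H 0%nat). lra.
Qed.

Lemma div_1_jb_bounds (b : R) (j : nat) : 0 <= b -> 0 < / (1 + INR j * b) <= 1.
Proof.
intros Hb. assert (Hj := pos_INR j).
assert (H : 1 <= 1 + INR j * b) by nra.
split; [apply Rinv_0_lt_compat; lra |].
rewrite <- Rinv_1. apply Rinv_le_contravar; lra.
Qed.

Lemma Rabs_sqrt_coef_div_le (b : R) (j : nat) :
  0 <= b -> Rabs (sqrt_coef j / (1 + INR j * b)) <= Rabs (sqrt_coef j).
Proof.
intros Hb. destruct (div_1_jb_bounds b j Hb) as [H1 H2].
unfold Rdiv. rewrite Rabs_mult, (Rabs_pos_eq (/ _)) by lra.
generalize (Rabs_pos (sqrt_coef j)). nra.
Qed.

Lemma ex_series_sqrt_coef_div (b : R) :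
  0 <= b -> ex_series (fun j => sqrt_coef j / (1 + INR j * b)).
Proof.
intros Hb.
apply (@ex_series_le R_AbsRing R_CompleteNormedModule) with (2 := ex_series_abs_sqrt_coef).
intros j. now apply Rabs_sqrt_coef_div_le.
Qed.

Definition dominant_at_m1 (b : R) : R := Series (fun j => sqrt_coef j / (1 + INR j * b)).

(** Coefficients of positive index are negative, so a larger denominator raises each such term. *)
Lemma dominant_at_m1_increasing (a b : R) :
  0 < a < b -> dominant_at_m1 a < dominant_at_m1 b.
Proof.
intros Hab.
assert (Hinv : forall j, / (1 + INR (S j) * b) < / (1 + INR (S j) * a)).
{ intros j. assert (Hj := lt_0_INR (S j) (Nat.lt_0_succ j)).
  apply Rinv_lt_contravar; [apply Rmult_lt_0_compat; nra | nra]. }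
apply Series_lt_at_1; try (apply ex_series_sqrt_coef_div; lra).
- intros [|j]; [simpl; rewrite !Rmult_0_l; lra |].
  generalize (Hinv j) (sqrt_coef_S_neg j). unfold Rdiv. nra.
- generalize (Hinv 0%nat) (sqrt_coef_S_neg 0). unfold Rdiv. nra.
Qed.

(** The intermediate value theorem wants continuity on all of R. The absolute value keeps the
    denominators at least 1, so the summable |[sqrt_coef j]| dominate everywhere. *)
Lemma continuity_dominant_at_m1 : continuity (fun b => dominant_at_m1 (Rabs b)).
Proof.
intros b. apply continuity_pt_filterlim.
apply (continuous_Series (U := R_UniformSpace)
  (fun j c => sqrt_coef j / (1 + INR j * Rabs c)) _ b ex_series_abs_sqrt_coef).
- apply filter_forall. intros c j. apply Rabs_sqrt_coef_div_le, Rabs_pos.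
- intros j. apply continuity_pt_filterlim.
  apply continuity_pt_mult; [apply continuity_pt_const; now intros ? ? |].
  apply continuity_pt_inv.
  + apply continuity_pt_plus; [apply continuity_pt_const; now intros ? ? |].
    apply continuity_pt_mult; [apply continuity_pt_const; now intros ? ? |].
    apply Rcontinuity_abs.
  + destruct (div_1_jb_bounds (Rabs b) j (Rabs_pos b)) as [H _].
    intros E. rewrite E, Rinv_0 in H. lra.
Qed.

(** At b = 0 the first four terms give 1 - 1/2 - 1/8 - 1/16 = 5/16 < 1/3, which leaves room for a
    small positive b; the tail is negative. *)
Lemma dominant_at_m1_small : dominant_at_m1 (1 / 1000) < 1 / 3.
Proof.
unfold dominant_at_m1.
rewrite (Series_incr_n _ 4) by (lia || (apply ex_series_sqrt_coef_div; lra)).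
assert (HT : Series (fun k => sqrt_coef (4 + k) / (1 + INR (4 + k) * (1 / 1000))) <= 0).
{ rewrite <- (Rmult_0_l (Series (fun k => - sqrt_coef (S k)))), <- Series_scal_l.
  apply Series_monotone.
  - intros k. rewrite Rmult_0_l.
    destruct (div_1_jb_bounds (1 / 1000) (4 + k) ltac:(lra)) as [H _].
    generalize (sqrt_coef_S_neg (3 + k)). change (S (3 + k)) with (4 + k)%nat.
    unfold Rdiv in *. nra.
  - apply (ex_series_incr_n (fun j => sqrt_coef j / (1 + INR j * (1 / 1000))) 4).
    apply ex_series_sqrt_coef_div. lra.
  - exact (ex_series_scal 0 _ ex_series_sqrt_coef_shift). }
simpl in *. lra.
Qed.

(** At b = 1 every term of positive index is at least halved, and the coefficients after the first
    sum to at least -1, so the value is at least 1/2. *)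
Lemma dominant_at_m1_large : 1 / 3 < dominant_at_m1 1.
Proof.
unfold dominant_at_m1.
rewrite Series_incr_1 by (apply ex_series_sqrt_coef_div; lra).
assert (HT : - (1 / 2) * Series (fun k => - sqrt_coef (S k)) <=
  Series (fun k => sqrt_coef (S k) / (1 + INR (S k) * 1))).
{ rewrite <- Series_scal_l. apply Series_monotone.
  - intros k. assert (H := sqrt_coef_S_neg k).
    assert (Hi : / (1 + INR (S k) * 1) <= / 2).
    { apply Rinv_le_contravar; [lra |]. rewrite S_INR. generalize (pos_INR k). lra. }
    unfold Rdiv. nra.
  - exact (ex_series_scal _ _ ex_series_sqrt_coef_shift).
  - apply (ex_series_incr_1 (fun j => sqrt_coef j / (1 + INR j * 1))).
    apply ex_series_sqrt_coef_div. lra. }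
assert (H := Series_sqrt_coef_shift_le). simpl (sqrt_coef 0 / _). lra.
Qed.

Lemma dominant_at_m1_root : exists b, 0 < b /\ dominant_at_m1 b = 1 / 3.
Proof.
destruct (IVT_gen (fun b => dominant_at_m1 (Rabs b)) (1 / 1000) 1 (1 / 3))
  as [b [Hb E]].
- exact continuity_dominant_at_m1.
- rewrite !Rabs_pos_eq by lra.
  generalize dominant_at_m1_small dominant_at_m1_large. intros H1 H2.
  rewrite Rmin_left, Rmax_right by lra. lra.
- rewrite Rmin_left, Rmax_right in Hb by lra.
  exists b. rewrite Rabs_pos_eq in E by lra. split; [lra | exact E].
Qed.

(** * Power series on [0, 1): the square root and its averaged form *)

Section PowerSeriesOnUnitInterval.

Variable (a : nat -> R).
Hypothesis a_le_1 : forall j, Rabs (a j) <= 1.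

Lemma CV_radius_unit (x : R) : 0 <= x < 1 -> Rbar_lt (Rabs x) (CV_radius a).
Proof.
intros Hx. apply Rbar_lt_le_trans with 1; [simpl; rewrite Rabs_pos_eq; lra |].
apply (proj1 (CV_radius_bounded a)). exists 1. intros n.
rewrite pow1, Rmult_1_r. apply a_le_1.
Qed.

Lemma ex_series_unit (x : R) : 0 <= x < 1 -> ex_series (fun j => a j * x ^ j).
Proof. intros Hx. now apply ex_pseries_R, CV_radius_inside, CV_radius_unit. Qed.

Lemma ex_series_derive_unit (x : R) :
  0 <= x < 1 -> ex_series (fun j => INR j * a j * x ^ j) /\
  x * PSeries (PS_derive a) x = Series (fun j => INR j * a j * x ^ j).
Proof.
intros Hx.
assert (H : ex_series (fun j => PS_derive a j * x ^ j)).
{ apply ex_pseries_R, CV_radius_inside. rewrite CV_radius_derive. now apply CV_radius_unit. }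
assert (H' : ex_series (fun j => INR j * a j * x ^ j)).
{ apply ex_series_incr_1. apply ex_series_ext with (2 := ex_series_scal x _ H).
  intros j. unfold PS_derive, scal; simpl. unfold mult; simpl. ring. }
split; [exact H' |].
rewrite (Series_incr_1 _ H'). unfold PSeries. rewrite <- Series_scal_l.
rewrite Rmult_0_l, Rmult_0_l, Rplus_0_l.
apply Series_ext. intros j. unfold PS_derive. simpl. ring.
Qed.

End PowerSeriesOnUnitInterval.

(** The recursion [sqrt_coef_S] is the equation (1 - x) y' = - y/2 read on coefficients. *)
Lemma PSeries_sqrt_coef_derive (x : R) :
  0 <= x < 1 -> (1 - x) * PSeries (PS_derive sqrt_coef) x = - (1 / 2) * PSeries sqrt_coef x.
Proof.
intros Hx. destruct (ex_series_derive_unit sqrt_coef Rabs_sqrt_coef_le_1 x Hx) as [H1 H2].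
assert (H0 := ex_series_unit sqrt_coef Rabs_sqrt_coef_le_1 x Hx).
rewrite Rmult_minus_distr_r, H2, Rmult_1_l.
unfold PSeries at 1.
rewrite (Series_ext _ (fun j => INR j * sqrt_coef j * x ^ j - 1 / 2 * (sqrt_coef j * x ^ j))).
- rewrite Series_minus, Series_scal_l by (trivial; exact (ex_series_scal _ _ H0)).
  unfold PSeries. lra.
- intros j. unfold PS_derive. rewrite sqrt_coef_S. ring.
Qed.

(** Both sides solve the same linear equation, so their quotient has derivative 0, and it equals 1
    at 0. *)
Lemma PSeries_sqrt_coef (x : R) : 0 <= x < 1 -> PSeries sqrt_coef x = sqrt (1 - x).
Proof.
intros Hx.
assert (Hd : forall y, 0 <= y <= x -> is_derive (fun y => PSeries sqrt_coef y / sqrt (1 - y)) y 0).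
{ intros y Hy. assert (Hs : 0 < sqrt (1 - y)) by (apply sqrt_lt_R0; lra).
  assert (H1 := is_derive_PSeries sqrt_coef y 
                 (CV_radius_unit sqrt_coef Rabs_sqrt_coef_le_1 y ltac:(lra))).
  assert (H2 : is_derive (fun y => sqrt (1 - y)) y (- / (2 * sqrt (1 - y)))).
  { auto_derive; [lra | change (1 + - y) with (1 - y); field; lra]. }
  assert (H := is_derive_div _ _ _ _ _ H1 H2 ltac:(lra)).
  replace 0 with ((PSeries (PS_derive sqrt_coef) y * sqrt (1 - y) -
    PSeries sqrt_coef y * - / (2 * sqrt (1 - y))) / sqrt (1 - y) ^ 2); [exact H |].
  assert (E := PSeries_sqrt_coef_derive y ltac:(lra)).
  assert (E2 := sqrt_sqrt (1 - y) ltac:(lra)).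
  rewrite <- E2 in E. set (r := sqrt (1 - y)) in *. clearbody r.
  replace (PSeries (PS_derive sqrt_coef) y) with (- (1 / 2) * PSeries sqrt_coef y / (r * r))
    by (rewrite <- E; field; lra).
  field. lra. }
destruct (MVT_gen (fun y => PSeries sqrt_coef y / sqrt (1 - y)) 0 x (fun _ => 0)) as [c [_ Hc]].
- intros y Hy. rewrite Rmin_left, Rmax_right in Hy by lra. apply Hd. lra.
- intros y Hy. rewrite Rmin_left, Rmax_right in Hy by lra.
  apply continuity_pt_filterlim,
    (ex_derive_continuous (fun y => PSeries sqrt_coef y / sqrt (1 - y)) y).
  eexists. now apply Hd.
- rewrite PSeries_0, Rminus_0_r, sqrt_1 in Hc.
  assert (Hs : 0 < sqrt (1 - x)) by (apply sqrt_lt_R0; lra).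
  change (sqrt_coef 0) with 1 in Hc.
  replace (PSeries sqrt_coef x) with (PSeries sqrt_coef x / sqrt (1 - x) * sqrt (1 - x))
    by (field; lra).
  replace (PSeries sqrt_coef x / sqrt (1 - x)) with 1 by lra. ring.
Qed.

(* [dominant b x] is the value at [-x] of the solution of q + b z q' = sqrt(1+z). *)
Definition dominant (b x : R) : R := PSeries (fun j => sqrt_coef j / (1 + INR j * b)) x.

Lemma Rabs_sqrt_coef_div_le_1 (b : R) :
  0 <= b -> forall j, Rabs (sqrt_coef j / (1 + INR j * b)) <= 1.
Proof.
intros Hb j. eapply Rle_trans; [now apply Rabs_sqrt_coef_div_le | apply Rabs_sqrt_coef_le_1].
Qed.

Lemma dominant_0 (b : R) : dominant b 0 = 1.
Proof. unfold dominant. rewrite PSeries_0. simpl. field. Qed.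

(** The operator y + b x y' multiplies x^j by 1 + j b, cancelling the denominators. The reflection z
    = -x changes nothing, as z d/dz = x d/dx. *)
Lemma dominant_ode (b x : R) :
  0 < b -> 0 <= x < 1 ->
  exists d, is_derive (dominant b) x d /\ dominant b x + b * x * d = sqrt (1 - x).
Proof.
intros Hb Hx. set (a := fun j => sqrt_coef j / (1 + INR j * b)).
assert (Ha := Rabs_sqrt_coef_div_le_1 b (Rlt_le _ _ Hb)). fold a in Ha.
exists (PSeries (PS_derive a) x). split.
- now apply is_derive_PSeries, CV_radius_unit.
- destruct (ex_series_derive_unit a Ha x Hx) as [H1 H2].
  assert (H0 := ex_series_unit a Ha x Hx).
  rewrite Rmult_assoc, H2, <- (PSeries_sqrt_coef x Hx). unfold dominant, PSeries. fold a.
  rewrite <- Series_scal_l, <- Series_plus by (trivial; exact (ex_series_scal _ _ H1)).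
  apply Series_ext. intros j. unfold a. field.
  destruct (div_1_jb_bounds b j (Rlt_le _ _ Hb)) as [H _].
  intros E. rewrite E, Rinv_0 in H. lra.
Qed.

Lemma dominant_gt (b x : R) : 0 < b -> 0 <= x < 1 -> dominant_at_m1 b < dominant b x.
Proof.
intros Hb Hx. apply Series_lt_at_1.
- intros [|j]; [simpl; lra |].
  destruct (div_1_jb_bounds b (S j) (Rlt_le _ _ Hb)) as [H _].
  assert (H1 := sqrt_coef_S_neg j).
  assert (H2 : x ^ S j <= 1) by (rewrite <- (pow1 (S j)); apply pow_incr; lra).
  assert (H3 : sqrt_coef (S j) / (1 + INR (S j) * b) < 0) by (unfold Rdiv; nra).
  nra.
- destruct (div_1_jb_bounds b 1 (Rlt_le _ _ Hb)) as [H _].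
  assert (H1 := sqrt_coef_S_neg 0).
  assert (H3 : sqrt_coef 1 / (1 + INR 1 * b) < 0) by (unfold Rdiv; nra).
  rewrite pow_1. nra.
- apply ex_series_sqrt_coef_div. lra.
- apply ex_series_unit; [apply Rabs_sqrt_coef_div_le_1; lra | exact Hx].
Qed.

(** At a negative minimum m > 0 the inequality forces D' m > 0, so [D] would be smaller just to the
    left of m. Looking left also covers m = 1, and m = 0 is excluded by the initial value. *)
Lemma ode_comparison (D D' : R -> R) (b : R) :
  0 < b -> 0 <= D 0 ->
  (forall t, 0 <= t <= 1 -> is_derive D t (D' t)) ->
  (forall t, 0 < t <= 1 -> 0 <= D t + b * t * D' t) ->
  0 <= D 1.
Proof.
intros Hb H0 Hd H.
destruct (continuity_ab_min D 0 1 ltac:(lra)) as [m [Hm Hm01]].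
{ intros c Hc. apply continuity_pt_filterlim, (ex_derive_continuous D c).
  eexists. now apply Hd. }
apply Rle_trans with (D m); [| apply Hm; lra].
apply Rnot_lt_le. intros Hneg.
assert (Hm0 : 0 < m).
{ destruct (Rle_lt_or_eq_dec 0 m) as [Hlt | E]; [lra | exact Hlt |]. subst m. lra. }
assert (HD : 0 < D' m).
{ specialize (H m ltac:(lra)). assert (Hbm : 0 < b * m) by nra. nra. }
assert (Hd' := Hd m ltac:(lra)). apply is_derive_Reals in Hd'.
destruct (Hd' (D' m) HD) as [d Hdd].
(* A step to the left, short enough for the derivative estimate and for m + h to stay in [0, 1]. *)
set (h := - Rmin (d / 2) m).
assert (Hdp := cond_pos d).
assert (Hh : - m <= h < 0 /\ Rabs h < d).
{ unfold h. rewrite Rabs_Ropp. generalize (Rmin_l (d / 2) m) (Rmin_r (d / 2) m).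
  assert (0 < Rmin (d / 2) m) by (apply Rmin_glb_lt; lra).
  rewrite Rabs_pos_eq by lra. lra. }
specialize (Hdd h ltac:(lra) (proj2 Hh)).
apply Rabs_def2 in Hdd. destruct Hdd as [_ Hdd].
assert (Hq : 0 < (D (m + h) - D m) / h) by lra.
assert (Hlt : D (m + h) - D m < 0).
{ replace (D (m + h) - D m) with ((D (m + h) - D m) / h * h) by (field; lra). nra. }
specialize (Hm (m + h) ltac:(lra)). lra.
Qed.

(** * Gauss's limit at the points -1/2 + j *)

Definition Gauss_seq (x : R) (n : nat) : R :=
  Rpower (INR n) x * INR (fact n) / prod_f_R0 (fun k => x + INR k) n.

Lemma prod_shift (x : R) (n : nat) :
  x * prod_f_R0 (fun k => x + 1 + INR k) n =
  prod_f_R0 (fun k => x + INR k) n * (x + INR (S n)).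
Proof.
induction n as [|n IH]; [simpl; ring |].
change (x * (prod_f_R0 (fun k => x + 1 + INR k) n * (x + 1 + INR (S n))) =
  prod_f_R0 (fun k => x + INR k) n * (x + INR (S n)) * (x + INR (S (S n)))).
rewrite <- Rmult_assoc, IH, (S_INR (S n)). ring.
Qed.

Lemma prod_neq_0 (f : nat -> R) (n : nat) :
  (forall k, f k <> 0) -> prod_f_R0 f n <> 0.
Proof.
intros H. induction n as [|n IH]; [apply H |]. simpl.
now apply Rmult_integral_contrapositive_currified.
Qed.

Lemma Gauss_seq_shift (x : R) (n : nat) :
  (forall k, x + INR k <> 0) -> (0 < n)%nat ->
  Gauss_seq (x + 1) n = x * (Gauss_seq x n * (1 - (x + 1) / (x + 1 + INR n))).
Proof.
intros Hx Hn. unfold Gauss_seq.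
assert (Hn0 : 0 < INR n) by now apply lt_0_INR.
rewrite Rpower_plus, Rpower_1 by exact Hn0.
assert (H1 := prod_shift x n).
assert (H2 := prod_neq_0 _ n Hx).
assert (H3 := Hx (S n)). assert (H4 := Hx 0%nat). simpl (INR 0) in H4. rewrite Rplus_0_r in H4.
replace (x + 1 + INR n) with (x + INR (S n)) by (rewrite S_INR; ring).
replace (prod_f_R0 (fun k => x + 1 + INR k) n)
  with (prod_f_R0 (fun k => x + INR k) n * (x + INR (S n)) / x)
  by (rewrite <- H1; field; exact H4).
rewrite S_INR in *. field. repeat split; trivial.
Qed.

(** This is Gamma(x + 1) = x Gamma(x) with existence of the limit carried along, so convergence has
    to be proved at -1/2 only. *)
Lemma Gauss_seq_lim_shift (x l : R) :
  (forall k, x + INR k <> 0) -> is_lim_seq (Gauss_seq x) l ->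
  is_lim_seq (Gauss_seq (x + 1)) (x * l).
Proof.
intros Hx Hl.
apply is_lim_seq_ext_loc
  with (fun n => x * (Gauss_seq x n * (1 - (x + 1) / (x + 1 + INR n)))).
- exists 1%nat. intros n Hn. symmetry. apply Gauss_seq_shift; [exact Hx | lia].
- replace (x * l) with (x * (l * (1 - (x + 1) * 0))) by ring.
  apply (is_lim_seq_scal_l _ x (l * (1 - (x + 1) * 0))).
  apply is_lim_seq_mult'; [exact Hl |].
  apply is_lim_seq_minus'; [apply is_lim_seq_const |].
  apply (is_lim_seq_scal_l (fun n => / (x + 1 + INR n)) (x + 1) 0).
  replace (Finite 0) with (Rbar_inv p_infty) by reflexivity.
  apply is_lim_seq_inv; [| easy].
  apply is_lim_seq_plus with (x + 1) p_infty;
    [apply is_lim_seq_const | apply is_lim_seq_INR | reflexivity].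
Qed.

(** Squaring replaces the real power n^(-1/2) by 1/n, so consecutive terms have a rational ratio. *)
Lemma Gauss_seq_mhalf_sq (n : nat) :
  Gauss_seq (- (1 / 2)) (S n) ^ 2 =
  (INR (fact (S n)) / prod_f_R0 (fun k => - (1 / 2) + INR k) (S n)) ^ 2 / INR (S n).
Proof.
unfold Gauss_seq.
assert (Hn : 0 < INR (S n)) by (apply lt_0_INR; lia).
replace (1 / 2) with (/ 2) by field.
rewrite Rpower_Ropp, Rpower_sqrt by exact Hn.
assert (Hs := sqrt_lt_R0 _ Hn). assert (E := sqrt_sqrt _ (Rlt_le _ _ Hn)).
unfold Rdiv. rewrite !Rpow_mult_distr, pow_inv.
replace (sqrt (INR (S n)) ^ 2) with (INR (S n)) by (rewrite <- E at 1; ring).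
ring.
Qed.

Lemma mhalf_plus_INR_neq_0 (k : nat) : - (1 / 2) + INR k <> 0.
Proof.
destruct k as [|k]; [simpl; lra |]. rewrite S_INR. generalize (pos_INR k). lra.
Qed.

Lemma Gauss_seq_mhalf_ratio (n : nat) :
  Gauss_seq (- (1 / 2)) (S (S n)) ^ 2 =
  Gauss_seq (- (1 / 2)) (S n) ^ 2 * (INR (S n) * INR (S (S n)) / (INR (S n) + 1 / 2) ^ 2).
Proof.
rewrite !Gauss_seq_mhalf_sq.
assert (H := prod_neq_0 _ (S n) mhalf_plus_INR_neq_0).
change (prod_f_R0 (fun k => - (1 / 2) + INR k) (S (S n)))
  with (prod_f_R0 (fun k => - (1 / 2) + INR k) (S n) * (- (1 / 2) + INR (S (S n)))).
rewrite fact_simpl, mult_INR.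
set (P := prod_f_R0 _ _) in *. clearbody P.
assert (Hn := pos_INR n). rewrite !(S_INR (S n)), (S_INR n).
field. repeat split; trivial; try lra.
Qed.

Lemma Gauss_seq_mhalf_neg (n : nat) : Gauss_seq (- (1 / 2)) n < 0.
Proof.
unfold Gauss_seq.
assert (HP : prod_f_R0 (fun k => - (1 / 2) + INR k) n < 0).
{ induction n as [|n IH]; [simpl; lra |].
  change (prod_f_R0 (fun k => - (1 / 2) + INR k) n * (- (1 / 2) + INR (S n)) < 0).
  rewrite S_INR. generalize (pos_INR n). nra. }
assert (H1 : 0 < Rpower (INR n) (- (1 / 2))) by apply exp_pos.
assert (H2 := INR_fact_lt_0 n).
apply Rinv_lt_0_compat in HP. assert (H3 := Rmult_lt_0_compat _ _ H1 H2).
unfold Rdiv. nra.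
Qed.

(** The ratio of consecutive squares is (n+1)(n+2)/(n+3/2)^2 <= 1, so the negative terms increase. A
    lower bound on the squares keeps them away from 0. *)
Lemma Gauss_seq_mhalf_lim :
  exists l, l <> 0 /\ is_lim_seq (Gauss_seq (- (1 / 2))) l.
Proof.
set (g := fun n => Gauss_seq (- (1 / 2)) (S n)).
assert (Hneg : forall n, g n < 0) by (intros n; apply Gauss_seq_mhalf_neg).
assert (Hratio : forall n, g (S n) ^ 2 =
  g n ^ 2 * ((INR n + 1) * (INR n + 2) / (INR n + 1 + 1 / 2) ^ 2)).
{ intros n. unfold g. rewrite Gauss_seq_mhalf_ratio, (S_INR (S n)), (S_INR n).
  do 2 f_equal. f_equal. ring. }
assert (Hincr : forall n, g n <= g (S n)).
{ intros n. assert (Hn := pos_INR n).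
  assert (Hq : (INR n + 1) * (INR n + 2) / (INR n + 1 + 1 / 2) ^ 2 <= 1).
  { apply Rmult_le_reg_r with ((INR n + 1 + 1 / 2) ^ 2); [nra |].
    field_simplify; nra. }
  assert (H1 := Hneg n). assert (H2 := Hneg (S n)). specialize (Hratio n).
  assert (H3 : g (S n) ^ 2 <= g n ^ 2) by (rewrite Hratio; nra).
  apply Rnot_lt_le. intros Hc. nra. }
(* The weight (n+1)/(n+2) makes the squares nondecreasing, since (n+2)^3 >= (n+3/2)^2 (n+3); at n =
   0 it equals 1/2. *)
assert (Hsq : forall n, g 0%nat ^ 2 / 2 <= g n ^ 2 * (INR n + 1) / (INR n + 2)).
{ induction n as [|n IH]; [simpl; lra |].
  apply Rle_trans with (1 := IH). rewrite Hratio, (S_INR n). assert (Hn := pos_INR n).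
  assert (H2 : 0 <= g n ^ 2) by nra.
  replace (g n ^ 2 * ((INR n + 1) * (INR n + 2) / (INR n + 1 + 1 / 2) ^ 2) * (INR n + 1 + 1)
           / (INR n + 1 + 2))
    with (g n ^ 2 * ((INR n + 1) * (INR n + 2) ^ 2 / ((INR n + 1 + 1 / 2) ^ 2 * (INR n + 3))))
    by (field; lra).
  unfold Rdiv at 1. rewrite Rmult_assoc. apply Rmult_le_compat_l; [exact H2 |].
  apply Rmult_le_reg_r with ((INR n + 2) * ((INR n + 1 + 1 / 2) ^ 2 * (INR n + 3)));
    [apply Rmult_lt_0_compat; nra |].
  field_simplify; try lra. nra. }
(* From g n^2 >= g 0^2 / 2 >= (g 0 / 2)^2; the weaker constant avoids a square root of 2. *)
set (c := - g 0%nat / 2).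
assert (Hup : forall n, g n <= - c).
{ intros n. unfold c. assert (H0 := Hneg 0%nat). assert (H1 := Hneg n).
  specialize (Hsq n). assert (Hn := pos_INR n).
  assert (Hq : (INR n + 1) / (INR n + 2) <= 1).
  { apply Rmult_le_reg_r with (INR n + 2); [lra |]. field_simplify; lra. }
  assert (H2 : g 0%nat ^ 2 / 2 <= g n ^ 2).
  { apply Rle_trans with (1 := Hsq). unfold Rdiv in *. rewrite Rmult_assoc. nra. }
  nra. }
destruct (ex_finite_lim_seq_incr g (- c) Hincr Hup) as [l Hl].
exists l. split.
- assert (Hle := is_lim_seq_le g (fun _ => - c) l (- c) Hup Hl (is_lim_seq_const _)).
  simpl in Hle. unfold c in Hle. generalize (Hneg 0%nat). lra.
- now apply is_lim_seq_incr_1.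
Qed.

(** The common factor [l] is Gamma(-1/2); it cancels in [root_fun_L], so being nonzero is all that
    matters. *)
Lemma Gamma_mhalf_plus :
  exists l, l <> 0 /\ forall j, Gamma (- (1 / 2) + INR j) = l * (sqrt_coef j * INR (fact j)).
Proof.
destruct Gauss_seq_mhalf_lim as [l [Hl0 Hl]]. exists l. split; [exact Hl0 |].
assert (H : forall j,
  is_lim_seq (Gauss_seq (- (1 / 2) + INR j)) (l * (sqrt_coef j * INR (fact j)))).
{ induction j as [|j IH].
  - simpl. now rewrite Rplus_0_r, !Rmult_1_r.
  - rewrite S_INR, <- Rplus_assoc.
    replace (l * (sqrt_coef (S j) * INR (fact (S j))))
      with ((- (1 / 2) + INR j) * (l * (sqrt_coef j * INR (fact j)))).
    + apply Gauss_seq_lim_shift; [| exact IH].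
      intros k. rewrite Rplus_assoc, <- plus_INR. apply mhalf_plus_INR_neq_0.
    + rewrite fact_simpl, mult_INR.
      replace (sqrt_coef (S j) * (INR (S j) * INR (fact j)))
        with (INR (S j) * sqrt_coef (S j) * INR (fact j)) by ring.
      rewrite sqrt_coef_S. ring. }
intros j. unfold Gamma. fold (Gauss_seq (- (1 / 2) + INR j)).
now rewrite (is_lim_seq_unique _ _ (H j)).
Qed.

Lemma root_fun_L_eq (b : R) : root_fun_L b = 3 * dominant_at_m1 b - 1.
Proof.
destruct Gamma_mhalf_plus as [l [Hl H]]. unfold root_fun_L, dominant_at_m1.
assert (E0 : Gamma (- (1 / 2)) = l).
{ generalize (H 0%nat). simpl. now rewrite Rplus_0_r, !Rmult_1_r. }
rewrite E0, (Series_ext _ (fun j => l * (sqrt_coef j / (1 + INR j * b)))).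
- rewrite Series_scal_l. field. exact Hl.
- intros j. rewrite H. unfold Rdiv. rewrite Rinv_mult.
  generalize (/ (1 + INR j * b)). intros k. field. apply INR_fact_neq_0.
Qed.

(** * The differential subordination *)

Local Open Scope C_scope.

Lemma Cinv_0 : / 0 = 0.
Proof. unfold Cinv, RtoC; simpl. f_equal; unfold Rdiv; ring. Qed.

Lemma Re_Csqrt_ge (w : C) (r : R) :
  (Cmod w <= r < 1)%R -> (sqrt (1 - r) <= Re (Csqrt (1 + w)))%R.
Proof.
intros Hr. unfold Csqrt. apply sqrt_le_1_alt.
assert (H1 := Cmod_minus_le 1 (- w)). rewrite Cmod_opp, Cmod_1 in H1.
replace (1 - - w) with (1 + w) in H1 by ring.
assert (H2 := re_le_Cmod w). apply Rabs_le_between in H2.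
change (Re (1 + w)) with (1 + Re w)%R. lra.
Qed.

(** With p = sqrt (1 + w) and q = sqrt (1 - r), (p - 1)(p + 1) = w and |w| <= r = (1 - q)(1 + q),
    while Re p >= q gives |p + 1| >= 1 + q. *)
Lemma Cmod_phi_L_minus_1 (w : C) (r : R) :
  (Cmod w <= r < 1)%R -> (Cmod (phi_L w - 1) <= 1 - sqrt (1 - r))%R.
Proof.
intros Hr. assert (H := Re_Csqrt_ge w r Hr). assert (E := Csqrt_sqr (1 + w)).
fold (phi_L w) in H, E. assert (Hs := sqrt_pos (1 - r)).
assert (Es := sqrt_sqrt (1 - r) ltac:(lra)).
set (q := sqrt (1 - r)) in *. set (p := phi_L w) in *.
assert (H1 : (1 + q <= Cmod (p + 1))%R).
{ apply Rle_trans with (Rabs (Re (p + 1))); [| apply re_le_Cmod].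
  change (Re (p + 1)) with (Re p + 1)%R. rewrite Rabs_pos_eq; lra. }
assert (H2 : (Cmod (p - 1) * Cmod (p + 1) = Cmod w)%R).
{ rewrite <- Cmod_mult. f_equal.
  replace ((p - 1) * (p + 1)) with (p * p - 1) by ring. rewrite E. ring. }
assert (H3 := Cmod_ge_0 (p - 1)). nra.
Qed.

Lemma phi_L_neq_0 (w : C) : (Cmod w < 1)%R -> phi_L w <> 0.
Proof.
intros Hw E. assert (H := Csqrt_sqr (1 + w)). fold (phi_L w) in H.
rewrite E, Cmult_0_l in H.
assert (Hw1 : w = -1) by (replace w with (1 + w - 1) by ring; rewrite <- H; ring).
rewrite Hw1, Cmod_R, Rabs_left in Hw; lra.
Qed.

(* The solution of p + b z p' = h is compared along the ray through [z] with the
   solution for the extremal right-hand side sqrt(1 - |z|). *)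
Lemma averaging_bound (p p' h : C -> C) (b : R) (z : C) :
  (0 < b)%R -> in_disk z -> p 0 = 1 ->
  (forall y, in_disk y -> cderiv p y (p' y)) ->
  (forall y, in_disk y -> p y + RtoC b * y * p' y = h y) ->
  (forall y, in_disk y -> (Cmod (h y - 1) <= 1 - sqrt (1 - Cmod y))%R) ->
  (Cmod (p z - 1) <= 1 - dominant b (Cmod z))%R.
Proof.
intros Hb Hz Hp0 Hd Hode Hh. unfold in_disk in Hz.
assert (Hz0 := Cmod_ge_0 z).
(* A fixed rotation [e] turns p(z) - 1 into its modulus, so the comparison concerns real functions
   of t; the factor 0 serves when p(z) = 1. *)
assert (He : exists e, (Cmod e <= 1)%R /\ Re (e * (p z - 1))%C = Cmod (p z - 1)).
{ destruct (Ceq_dec (p z - 1) 0) as [E | Hn].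
  - exists 0. rewrite E, !Cmod_0. split; [lra |]. simpl. ring.
  - set (c := p z - 1) in *. clearbody c. apply Cmod_gt_0 in Hn as Hc.
    exists (Cconj c / RtoC (Cmod c)).
    assert (Hc0 : RtoC (Cmod c) <> 0) by (intros E; apply RtoC_inj in E; lra).
    split.
    + rewrite Cmod_div, Cmod_conj, Cmod_R, Rabs_pos_eq by (trivial; lra).
      apply Req_le. field. lra.
    + replace (Cconj c / RtoC (Cmod c) * c) with (RtoC (Cmod c)); [reflexivity |].
      replace (Cconj c / RtoC (Cmod c) * c) with (c * Cconj c / RtoC (Cmod c))
        by (field; exact Hc0).
      rewrite <- Cmod2_conj, RtoC_pow. field. exact Hc0. }
destruct He as [e [He1 He2]].
assert (Hray : forall t, (0 <= t <= 1)%R -> in_disk (RtoC t * z) /\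
  Cmod (RtoC t * z) = (t * Cmod z)%R /\ (0 <= t * Cmod z < 1)%R).
{ intros t Ht. assert (E : Cmod (RtoC t * z) = (t * Cmod z)%R).
  { rewrite Cmod_mult, Cmod_R, Rabs_pos_eq by lra. reflexivity. }
  assert (H : (0 <= t * Cmod z < 1)%R) by nra.
  unfold in_disk. rewrite E. lra. }
(* By the two equations D + b t D' equals 1 - sqrt (1 - t |z|) - Re (e (h - 1)) along the ray, which
   the bound on [h] makes nonnegative. *)
set (D := fun t => (1 - dominant b (t * Cmod z) - Re (e * (p (RtoC t * z) - 1))%C)%R).
set (Q' := fun t => (Derive (dominant b) (t * Cmod z) * Cmod z)%R).
set (D' := fun t => (- Q' t - Re (e * (p' (RtoC t * z) * z))%C)%R).
cut (0 <= D 1)%R.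
{ unfold D. rewrite Cmult_1_l, Rmult_1_l, He2. lra. }
assert (HQ : forall t, (0 <= t <= 1)%R ->
  is_derive (dominant b) (t * Cmod z)%R (Derive (dominant b) (t * Cmod z)) /\
  (dominant b (t * Cmod z) + b * t * Q' t = sqrt (1 - t * Cmod z))%R).
{ intros t Ht. destruct (Hray t Ht) as [_ [_ H]].
  destruct (dominant_ode b (t * Cmod z) Hb H) as [d [H1 H2]].
  unfold Q'. rewrite (is_derive_unique _ _ _ H1). split; [exact H1 |].
  rewrite <- H2. ring. }
apply ode_comparison with D' b; [exact Hb | | |].
- unfold D. rewrite Cmult_0_l, Hp0, Rmult_0_l, dominant_0.
  replace (e * (1 - 1)) with (RtoC 0) by ring. simpl. lra.
- intros t Ht. destruct (Hray t Ht) as [Hin _]. destruct (HQ t Ht) as [HQ1 _].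
  apply (@is_derive_minus R_AbsRing R_NormedModule).
  + replace (- Q' t)%R with (0 - Q' t)%R by ring.
    apply (@is_derive_minus R_AbsRing R_NormedModule); [apply @is_derive_const |].
    unfold Q'. rewrite Rmult_comm.
    apply (is_derive_comp (dominant b) (fun t => (t * Cmod z)%R)); [exact HQ1 |].
    auto_derive; [trivial | ring].
  + apply rderiv_Re. apply (gderiv_scal (U := R_UniformSpace)).
    cut (rderiv (fun t => p (RtoC t * z) - 1) t (p' (RtoC t * z) * (1 * z + RtoC t * 0) + 0)).
    { now replace (p' (RtoC t * z) * (1 * z + RtoC t * 0) + 0) with (p' (RtoC t * z) * z) by ring. }
    apply (gderiv_plus (U := R_UniformSpace)); [| apply gderiv_const].
    apply (gderiv_comp (U := R_UniformSpace) RtoC ccont_RtoC p (fun t => RtoC t * z));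
      [now apply Hd |].
    apply (gderiv_mult (U := R_UniformSpace) RtoC ccont_RtoC RtoC (fun _ => z));
      [apply (gderiv_id (U := R_UniformSpace) RtoC) | apply gderiv_const].
- intros t Ht. destruct (Hray t ltac:(lra)) as [Hin [E _]].
  destruct (HQ t ltac:(lra)) as [_ HQ2].
  assert (H := Hh _ Hin). rewrite E in H.
  assert (HR : (Re (e * (h (RtoC t * z) - 1))%C <= 1 - sqrt (1 - t * Cmod z))%R).
  { apply Rle_trans with (2 := H).
    apply Rle_trans with (Cmod (e * (h (RtoC t * z) - 1))).
    - eapply Rle_trans; [apply Rle_abs | apply re_le_Cmod].
    - rewrite Cmod_mult. generalize (Cmod_ge_0 (h (RtoC t * z) - 1)). nra. }
  rewrite <- (Hode _ Hin) in HR.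
  replace (e * (p (RtoC t * z) + RtoC b * (RtoC t * z) * p' (RtoC t * z) - 1))
    with (e * (p (RtoC t * z) - 1) + RtoC (b * t) * (e * (p' (RtoC t * z) * z))) in HR
    by (rewrite RtoC_mult; ring).
  rewrite re_plus, re_scal_l in HR. unfold D, D'. lra.
Qed.

Section Star.

Variable f : C -> C.
Hypothesis f_classA : classA f.
Hypothesis f_neq_0 : forall z, in_disk z -> z <> 0 -> f z <> 0.

Lemma div_var_neq_0 (z : C) : in_disk z -> div_var f z <> 0.
Proof.
intros Hz. destruct f_classA as [_ [H0 H1]].
destruct (Ceq_dec z 0) as [E | Hn].
- subst z. unfold div_var. destruct (Ceq_dec 0 0) as [_ | H]; [| easy].
  rewrite H1. exact C1_nz.
- intros E. apply (f_neq_0 z Hz Hn). rewrite (div_var_mult f z H0), E. ring.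
Qed.

(** Writing z f'/f as f' / (f/z) removes the exceptional point 0: both parts are analytic there and
    the denominator is 1. *)
Lemma star_quotient_div_var (z : C) :
  in_disk z -> star_quotient f z = C_derive f z / div_var f z.
Proof.
intros Hz. destruct f_classA as [_ [H0 H1]]. unfold star_quotient, div_var.
destruct (Ceq_dec z 0) as [E | Hn].
- subst z. rewrite H1. field.
- field. split; [exact Hn | now apply f_neq_0].
Qed.

Lemma analytic_star_quotient : analytic_on_disk (star_quotient f).
Proof.
destruct f_classA as [Hf [H0 H1]].
apply analytic_on_disk_C1. intros z Hz.
apply C1_at_ext_loc with (fun z => C_derive f z / div_var f z).
- apply (filter_imp _ _) with (2 := locally_Cmod_lt z 1 Hz). intros x Hx.
  symmetry. now apply star_quotient_div_var.
- apply C1_at_div.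
  + now apply analytic_on_disk_C1; [apply analytic_on_disk_C_derive |].
  + now apply analytic_on_disk_C1; [apply analytic_on_disk_div_var |].
  + now apply div_var_neq_0.
Qed.

(** Logarithmic differentiation of p = z f'/f gives z p'/p = [calG f z]. At 0 both sides are 1. *)
Lemma star_quotient_ode (b : R) (z : C) :
  in_disk z -> C_derive f z <> 0 ->
  star_quotient f z + RtoC b * z * C_derive (star_quotient f) z =
  (1 + RtoC b * calG f z) * star_quotient f z.
Proof.
intros Hz Hf'. destruct f_classA as [Hf [H0 H1]].
destruct (Ceq_dec z 0) as [E | Hn].
- subst z. unfold calG, star_quotient at 1 3 4.
  destruct (Ceq_dec 0 0) as [_ | H]; [| easy]. rewrite H1. field.
- assert (Hfz := f_neq_0 z Hz Hn).
  destruct (analytic_on_disk_derive f z Hf Hz) as [D1 _].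
  destruct (analytic_on_disk_derive _ z (analytic_on_disk_C_derive f Hf) Hz) as [D2 _].
  assert (D : cderiv (fun x => x * C_derive f x * / f x) z
    ((1 * C_derive f z + z * C_derive (C_derive f) z) * / f z +
     z * C_derive f z * (- / (f z * f z) * C_derive f z))).
  { apply (gderiv_mult (U := CU) _ ccont_id (fun x => x * C_derive f x) (fun x => / f x)).
    - apply (gderiv_mult (U := CU) _ ccont_id (fun x => x)); [| exact D2].
      apply (gderiv_id (U := CU) (fun x => x)).
    - apply (gderiv_comp (U := CU) _ ccont_id Cinv f); [now apply cderiv_inv | exact D1]. }
  apply cderiv_ext_loc with (g := star_quotient f) in D.
  + rewrite (cderiv_unique_C_derive _ _ _ D). unfold calG, star_quotient.
    destruct (Ceq_dec z 0) as [E | _]; [easy |]. field. now split.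
  + apply (filter_imp _ _) with (2 := locally_neq_0 z Hn). intros x Hx.
    unfold star_quotient. now destruct (Ceq_dec x 0).
Qed.

End Star.

Theorem corollary5p1 :
  exists betaL : R,
    unique (fun b : R => (0 < b)%R /\ root_fun_L b = 0%R) betaL /\
    forall (f : C -> C) (beta : R),
      classA f ->
      (0 < beta)%R ->
      subordinate
        (fun z : C => ((1 + RtoC beta * calG f z) * star_quotient f z)%C)
        phi_L ->
      (betaL <= beta)%R ->
      class_SNe f.
Proof.
destruct dominant_at_m1_root as [bL [HbL EbL]].
exists bL. split.
{ split.
  - split; [exact HbL |]. rewrite root_fun_L_eq. lra.
  - intros b [Hb Eb]. rewrite root_fun_L_eq in Eb.
    destruct (Rtotal_order bL b) as [Hlt | [Heq | Hgt]]; [| exact Heq |].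
    + generalize (dominant_at_m1_increasing bL b (conj HbL Hlt)). lra.
    + generalize (dominant_at_m1_increasing b bL (conj Hb Hgt)). lra. }
intros f b Hf Hb [_ [_ [w [Hw [Hw0 [Hw1 Hsub]]]]]] Hle.
assert (Hne : forall z, in_disk z -> star_quotient f z <> 0).
{ intros z Hz E. apply (phi_L_neq_0 (w z) (Hw1 z Hz)).
  rewrite <- (Hsub z Hz), E. ring. }
assert (Hf0 : forall z, in_disk z -> z <> 0 -> f z <> 0).
{ intros z Hz Hn E. apply (Hne z Hz). unfold star_quotient.
  destruct (Ceq_dec z 0) as [E0 | _]; [easy |].
  rewrite E. unfold Cdiv. rewrite Cinv_0. ring. }
assert (Hf' : forall z, in_disk z -> C_derive f z <> 0).
{ intros z Hz E. apply (Hne z Hz). unfold star_quotient.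
  destruct (Ceq_dec z 0) as [E0 | _].
  - subst z. destruct Hf as [_ [_ H1]]. rewrite H1 in E. now contradiction C1_nz.
  - rewrite E. unfold Cdiv. ring. }
assert (Hp := analytic_star_quotient f Hf Hf0).
assert (Hp0 : star_quotient f 0 = 1).
{ unfold star_quotient. now destruct (Ceq_dec 0 0). }
assert (Hbound : forall z, in_disk z -> (Cmod (star_quotient f z - 1) < 2 / 3)%R).
{ intros z Hz. apply Rle_lt_trans with (1 - dominant b (Cmod z))%R.
  - apply averaging_bound with (C_derive (star_quotient f)) (fun z => phi_L (w z)); trivial.
    + intros y Hy. now apply analytic_on_disk_derive.
    + intros y Hy. rewrite <- (Hsub y Hy).
      apply star_quotient_ode; trivial. now apply Hf'.
    + intros y Hy. apply Cmod_phi_L_minus_1.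
      split; [now apply Schwarz_lemma | exact Hy].
  (* Strictness already comes from |z| < 1, so the end point beta = beta_L is included. *)
  - assert (H1 := dominant_gt b (Cmod z) Hb (conj (Cmod_ge_0 z) Hz)).
    destruct (Rle_lt_or_eq_dec _ _ Hle) as [Hlt | E].
    + generalize (dominant_at_m1_increasing bL b (conj HbL Hlt)). lra.
    + subst b. lra. }
split; [exact Hf |].
split; [exact Hp | split; [exact analytic_phi_Ne |]].
exists (fun z => Ne_inv (star_quotient f z - 1)). repeat split.
- apply analytic_on_disk_C1. intros z Hz.
  apply (C1_at_comp Ne_inv (fun z => star_quotient f z - 1)).
  + now apply C1_at_Ne_inv, Hbound.
  + apply (C1_at_plus (star_quotient f) (fun _ => - (1))); [| apply C1_at_const].
    now apply analytic_on_disk_C1.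
- rewrite Hp0. replace (1 - 1) with (RtoC 0) by ring. exact Ne_inv_0.
- intros z Hz. now apply Ne_inv_lt_1, Hbound.
- intros z Hz. rewrite phi_Ne_inv by now apply Hbound. ring.
Qed.
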